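(* Suppose that the general assumptions (G1)--(G6) listed in the context hold, and let $\beta\colon R\to[0,\infty)$ be continuous with $\beta(r)=0$ if and only if $r\in K$. Let $(\gamma_N)\subset(0,\infty)$ satisfy $\gamma_N\to\infty$ as $N\to\infty$. For each $N$, let $u_N^{\gamma_N}$ be a solution and $\widehat{\vartheta}_N^{\gamma_N}$ the optimal value of the regularized SAA problem $$\min_{u\in U}\ \widehat{F}_N(u)+\psi(u)+\gamma_N\,\frac1N\sum_{i=1}^N\beta(G(u,\xi^i)),$$ and let $\vartheta^\star$ be the optimal value of problem (P). Then, w.p.1, $\widehat{\vartheta}_N^{\gamma_N}\to\vartheta^\star$ as $N\to\infty$, and each weak$^*$ limit point of $(u_N^{\gamma_N})$ solves (P).
   Context: Probabilistic setting: $(\Omega,\mathcal{F},P)$ is a complete probability space; $\Xi$ is a complete separable metric space with its Borel $\sigma$-algebra; $\xi\colon\Omega\to\Xi$ is a random element whose law $\mathbb{P}$ is assumed complete; $\xi^1,\xi^2,\ldots$ are independent $\Xi$-valued random elements on $(\Omega,\mathcal{F},P)$, each with law $\mathbb{P}$; $\mathbb{E}$ denotes expectation. ''W.p.1'' means for $P$-a.e. $\omega\in\Omega$; dependence on $\omega$ is suppressed. General assumptions: (G1) $W$, $R$, $R_0$ are real separable Banach spaces with $R\subset R_0$, and $U$ is the dual of a real separable Banach space. (G2) $B\colon U\to W$ is linear and sequentially weakly$^*$-to-strongly continuous ($u_N\rightharpoonup^* u$ implies $Bu_N\to Bu$ in $W$). (G3) $\mathscr{J}\colon W\times\Xi\to[0,\infty)$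 is random lower semicontinuous, i.e., $\xi\mapsto\{(w,t)\in W\times\mathbb{R}\mid \mathscr{J}(w,\xi)\le t\}$ is a random closed set (a measurable closed-valued multifunction). (G4) $\mathscr{G}\colon W\times\Xi\to R_0$ is Carath\'eodory (continuous in the first argument, measurable in the second), $\mathscr{G}(Bu,\xi)\in R$ for all $(u,\xi)\in U\times\Xi$, and $\mathscr{G}\colon B(\mathrm{dom}(\psi))\times\Xi\to R$ is Carath\'eodory. Moreover, $K\subset R$ is a nonempty, closed, convex cone. (G5) $\psi\colon U\to[0,\infty]$ is proper, convex, and sequentially weakly$^*$ lower semicontinuous, with a bounded, weakly$^*$ sequentially closed domain $\mathrm{dom}(\psi)=\{u\in U\mid\psi(u)<\infty\}$. (G6) Problem (P) below has a feasible point with finite objective function value. Notation: $J(u,\xi):=\mathscr{J}(Bu,\xi)$, $G(u,\xi):=\mathscr{G}(Bu,\xi)$, $F\colon U\to[0,\infty)$, $F(u):=\mathbb{E}[J(u,\xi)]$, and $\widehat{F}_N(u):=\frac1N\sum_{i=1}^N J(u,\xi^i)$. Problem (P): $\min_{u\in U} F(u)+\psi(u)$ subject to $G(u,\xi)\in K$ for $\mathbb{P}$-a.e. $\xi\in\Xi$. *)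

(* Defs.v *)
From HB Require Import structures.
From mathcomp Require Import all_boot all_order all_algebra finmap.
From mathcomp Require Import all_classical all_reals all_analysis.
From mathcomp Require Import measurable_realfun.

Set Implicit Arguments.
Unset Strict Implicit.
Unset Printing Implicit Defensive.

Import Order.TTheory GRing.Theory Num.Theory.
Import numFieldNormedType.Exports.

Local Open Scope classical_set_scope.
Local Open Scope ring_scope.

#[short(type="completeMetricType")]
HB.structure Definition CompleteMetric (R : numDomainType) :=
  {T of Metric R T & Complete T}.

Definition separable (T : topologicalType) :=
  exists2 D : set T, countable D & dense D.

Notation borel T := (g_sigma_algebraType (@open T)).

(* Measurable sets are the unions of a measurable set and a [mu]-negligible one,
   i.e. the completion of the sigma-algebra on which [mu] is defined. *)
Notation completed mu := (g_sigma_algebraType (completed_algebra_gen mu)).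

Section Dual.
Context (R : realType) (V : normedModType R).

Definition lincont : {pred V -> R^o} :=
  [pred f : V -> R^o | `[< linear f /\ continuous f >]].

Lemma lincont_submod : submod_closed lincont.
Proof.
split=> [|a f g /asboolP[lf cf] /asboolP[lg cg]]; apply/asboolP; split.
- by move=> a x y /=; rewrite /GRing.zero /= scaler0 addr0.
- by move=> x; exact: cvg_cst.
- move=> b x y.
  have E z : (a *: f + g) z = a *: f z + g z by [].
  rewrite !E lf lg !scalerDr !scalerA (mulrC b a).
  by rewrite addrACA.
- by move=> x; apply: continuousD; [apply: continuousZr; exact: cf|exact: cg].
Qed.

HB.instance Definition _ :=
  GRing.isSubmodClosed.Build R (V -> R^o) lincont lincont_submod.

Record dual := Dual { dual_fun :> V -> R^o; _ : dual_fun \in lincont }.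

HB.instance Definition _ := [isSub for dual_fun].
HB.instance Definition _ := [Choice of dual by <:].
HB.instance Definition _ := [SubChoice_isSubLmodule of dual by <:].

Definition dual_norm (f : dual) : R :=
  sup [set `|f v| | v in [set v : V | `|v| <= 1]].

Definition dual_bounded (A : set dual) :=
  exists M : R, forall f, A f -> dual_norm f <= M.

(* Weak* topology: a copy of [dual] with the topology induced by pointwise
   convergence on [V]. *)
Definition weakstar : Type :=
  initial_topology (fun f : dual => (f : {ptws V -> R^o})).
HB.instance Definition _ := Topological.on weakstar.

Definition weakstar_cvg (u_ : nat -> dual) (u : dual) :=
  (u_ : nat -> weakstar) @ \oo --> (u : weakstar).

Definition weakstar_limit_point (u_ : nat -> dual) (u : dual) :=
  cluster ((u_ : nat -> weakstar) @ \oo) (u : weakstar).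

Definition seq_weakstar_closed (A : set dual) :=
  forall (u_ : nat -> dual) u,
    (forall n, A (u_ n)) -> weakstar_cvg u_ u -> A u.

Definition seq_weakstar_lsc (psi : dual -> \bar R) :=
  forall (u_ : nat -> dual) u,
    weakstar_cvg u_ u -> (psi u <= limn_einf (psi \o u_))%E.

End Dual.

Definition effective_domain (R : realType) (U : Type) (psi : U -> \bar R) :=
  [set u | (psi u < +oo)%E].

Definition proper_fun (R : realType) (U : Type) (psi : U -> \bar R) :=
  (forall u, -oo < psi u)%E /\ effective_domain psi !=set0.

(* [0 * +oo = 0] in [\bar R], so the end points of [0, 1] impose nothing. *)
Definition econvex (R : realType) (U : lmodType R) (psi : U -> \bar R) :=
  forall (u v : U) (t : R), 0 <= t <= 1 ->
    (psi (t *: u + (1 - t) *: v)%R <= t%:E * psi u + (1 - t)%:E * psi v)%E.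

Definition cone (R : realType) (U : lmodType R) (K : set U) :=
  forall (t : R) x, 0 < t -> K x -> K (t *: x).

Section Random.
Context d (S : measurableType d) (R : realType).

(* Effros measurability: preimages of open sets are measurable. *)
Definition random_closed_set (T : topologicalType) (X : S -> set T) :=
  (forall s, closed (X s)) /\
  forall O : set T, open O -> measurable [set s | X s `&` O !=set0].

Definition random_lsc (T : topologicalType) (f : T -> S -> R) :=
  random_closed_set (fun s => [set wt : T * R^o | f wt.1 s <= wt.2]).

Definition caratheodory_on (T : topologicalType) (E : ptopologicalType)
    (A : set T) (f : T -> S -> E) :=
  (forall s, {within A, continuous (f ^~ s)}) /\
  forall t, A t -> measurable_fun [set: S] (f t : S -> borel E).

End Random.
Arguments random_lsc {d} S {R T} f.
Arguments caratheodory_on {d} S {T E} A f.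

Section Sampling.
Context d d' (Omega : measurableType d) (S : measurableType d') (R : realType).
Variable P : probability Omega R.
Local Open Scope ereal_scope.

Definition mutually_independent (X : nat -> {RV P >-> S}) :=
  forall (I : {fset nat}) (A : nat -> set S), (forall i, measurable (A i)) ->
    P (\bigcap_(i in [set` I]) X i @^-1` A i) =
    \prod_(i <- I) P (X i @^-1` A i).

Definition same_law (X Y : {RV P >-> S}) :=
  forall A, measurable A -> distribution P X A = distribution P Y A.

End Sampling.

Section Programs.
Context (R : realType) (U : Type).
Local Open Scope ereal_scope.

Definition optimal_value (D : set U) (f : U -> \bar R) : \bar R :=
  ereal_inf (f @` D).

Definition is_solution (D : set U) (f : U -> \bar R) (u : U) :=
  D u /\ forall v, D v -> f u <= f v.

Definition feasible d (S : measurableType d) (mu : {measure set S -> \bar R})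
    (Y : Type) (K : set Y) (G : U -> S -> Y) : set U :=
  [set u | {ae mu, forall x, K (G u x)}].

Definition expected_cost d (Omega : measurableType d) (P : probability Omega R)
    (S : Type) (xi : Omega -> S) (J : U -> S -> R) (u : U) : \bar R :=
  'E_P[fun w => J u (xi w)].

(* The sample x^1, ..., x^N is [x 0, ..., x N.-1]; the value at [N = 0] is 0. *)
Definition sample_mean (S : Type) (f : S -> R) (x : nat -> S) (N : nat) : R :=
  (N%:R^-1 * \sum_(i < N) f (x i))%R.

Definition saa_objective (S Y : Type) (J : U -> S -> R) (G : U -> S -> Y)
    (psi : U -> \bar R) (beta : Y -> R) (gamma : R) (x : nat -> S) (N : nat)
    (u : U) : \bar R :=
  (sample_mean (J u) x N)%:E + psi u +
  (gamma * sample_mean (fun s => beta (G u s)) x N)%:E.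

End Programs.

(* Main.v *)
Require Import Defs.
From HB Require Import structures.
From mathcomp Require Import all_boot all_order all_algebra finmap.
From mathcomp Require Import all_classical all_reals all_analysis.
From mathcomp Require Import measurable_realfun.
From mathcomp Require Import ring lra.

Set Implicit Arguments.
Unset Strict Implicit.
Unset Printing Implicit Defensive.

Import Order.TTheory GRing.Theory Num.Theory.
Import numFieldNormedType.Exports.

Local Open Scope classical_set_scope.
Local Open Scope ring_scope.

(** The values of the regularized problems are squeezed between two almost sure
    estimates.

    Upper estimate. A feasible point [v] pays no penalty on almost every sample,
    so its sampled objective is eventually at most [F v + psi v + e] by a strong
    law of large numbers ([lln_upper]). Applied to countably many feasible points
    whose objectives approach the optimal value, this bounds the limit superior
    of the regularized optimal values.

    Lower estimate. The minimizers stay in the domain of [psi], a norm-bounded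
    subset of the dual of a separable space, so they have weak* convergent
    subsequences ([bounded_weakstar_limit_point], [cluster_weakstar_subsequence]),
    which [B] turns into strongly convergent sequences of [W]. Almost surely and
    simultaneously for all points [v] of a set [C], the sample means of a
    nonnegative integrand, lower semicontinuous on [C], are eventually above any
    number below its expectation at [v], on a whole neighbourhood of [v] in [C]
    ([epi_lln_lower]); [C] is [W] for the cost and the image under [B] of the
    domain of [psi] for the penalty. For the cost this gives lower
    semicontinuity along the subsequence. For the penalty it shows that a limit
    point where the expected penalty is positive would make the values blow up,
    because the penalty parameters tend to infinity; hence limit points are
    feasible. Together: if values at most [c] are attained along a weak*
    convergent subsequence, its limit is feasible with objective at most [c]
    ([subsequence_limit_feasible]). Convergence of the values and optimality of
    the limit points both follow ([penalized_limit]).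

    The uniformity in [epi_lln_lower] costs only countably many strong laws: the
    infima of the integrand over the balls of a countable base, truncated at an
    integer, are bounded, and by lower semicontinuity and the lemma of Fatou their
    expectations approach the expectation at [v].

    The strong laws rest on the inequality of Chebyshev for pairwise independent
    variables ([iid_chebyshev]) along the squares for bounded variables
    ([lln_bounded_lower]) and along the powers of two for truncated ones
    ([lln_coarse_upper]). The integrands are measurable only for the completion
    of the law; since the probability is complete, composing them with the samples
    still yields pairwise independent, identically distributed real variables
    ([pairwise_iid_completed]). *)

(** * Pairwise independent, identically distributed real variables *)

Section pairwise_iid.
Context d (Omega : measurableType d) (R : realType) (P : probability Omega R).
Implicit Types Z : nat -> Omega -> R.
Local Open Scope ereal_scope.

Definition pairwise_iid Z :=
  [/\ forall i, measurable_fun setT (Z i),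
      forall i A, measurable A -> P (Z i @^-1` A) = P (Z 0%N @^-1` A) &
      forall (i j : nat) A B, i != j -> measurable A -> measurable B ->
        P (Z i @^-1` A `&` Z j @^-1` B) = P (Z i @^-1` A) * P (Z j @^-1` B)].

Lemma pairwise_iid_comp Z (g : R -> R) :
  measurable_fun setT g -> pairwise_iid Z -> pairwise_iid (fun i => g \o Z i).
Proof.
move=> mg [mZ lZ iZ].
have mg' A : measurable A -> measurable (g @^-1` A).
  by move=> mA; rewrite -[_ @^-1` _]setTI; exact: mg.
split=> [i|i A mA|i j A B ij mA mB].
- exact: measurableT_comp.
- exact: (lZ i _ (mg' A mA)).
- exact: (iZ i j _ _ ij (mg' A mA) (mg' B mB)).
Qed.

Lemma same_law_integral (X Y : Omega -> R) (g : R -> \bar R) :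
    measurable_fun setT X -> measurable_fun setT Y ->
    (forall A, measurable A -> P (X @^-1` A) = P (Y @^-1` A)) ->
    measurable_fun setT g -> (forall x, 0 <= g x) ->
  \int[P]_w g (X w) = \int[P]_w g (Y w).
Proof.
move=> mX mY XY mg g0.
pose X' : {mfun Omega >-> R} := HB.pack X (isMeasurableFun.Build _ _ _ _ _ mX).
pose Y' : {mfun Omega >-> R} := HB.pack Y (isMeasurableFun.Build _ _ _ _ _ mY).
transitivity (\int[distribution P X']_y g y).
  by rewrite ge0_integral_distribution.
transitivity (\int[distribution P Y']_y g y).
  by apply: eq_measure_integral => A mA _; exact: XY.
by rewrite ge0_integral_distribution.
Qed.

Lemma iid_integral Z (g : R -> \bar R) i : pairwise_iid Z ->
    measurable_fun setT g -> (forall x, 0 <= g x) ->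
  \int[P]_w g (Z i w) = \int[P]_w g (Z 0%N w).
Proof. by move=> [mZ lZ _]; apply: same_law_integral => // A; exact: lZ. Qed.

(** The joint law of two of the variables is the product of their laws, so the
    identity is the theorem of Tonelli. *)
Lemma iid_integralM Z i j : pairwise_iid Z -> (forall k w, 0 <= Z k w)%R -> i != j ->
  \int[P]_w (Z i w * Z j w)%:E = (\int[P]_w (Z 0%N w)%:E) * (\int[P]_w (Z 0%N w)%:E).
Proof.
move=> iidZ Z0 ij; have [mZ lZ iZ] := iidZ.
pose X j : {mfun Omega >-> R} := HB.pack (Z j) (isMeasurableFun.Build _ _ _ _ _ (mZ j)).
have mpair : measurable_fun setT (fun w => (Z i w, Z j w)) by exact: measurable_fun_pair.
pose XX : {mfun Omega >-> (R * R)%type} := HB.pack (fun w => (Z i w, Z j w))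
  (isMeasurableFun.Build _ _ _ _ _ mpair).
(* Absolute values make the integrand nonnegative on the whole plane, as the
   theorem of Tonelli requires, without changing it on the range of the pair. *)
pose f (p : (R * R)%type) := (`|p.1| * `|p.2|)%:E.
have mf : measurable_fun setT f.
  apply/measurable_EFinP; apply: measurable_funM; apply: measurableT_comp => //.
have f0 p : 0 <= f p by rewrite lee_fin mulr_ge0.
transitivity (\int[distribution P XX]_y f y).
  rewrite ge0_integral_distribution//; apply: eq_integral => w _.
  by rewrite /f /= !ger0_norm.
transitivity (\int[distribution P (X i) \x distribution P (X j)]_y f y).
  apply: eq_measure_integral => A mA _; apply/esym.
  apply: product_measure_unique => // B C mB mC.
  exact: iZ.
rewrite fubini_tonelli1//.
have mabs : measurable_fun setT (fun x : R => `|x|%:E).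
  by apply/measurable_EFinP; exact: normr_measurable.
have m0 k : measurable_fun setT (fun w => (Z k w)%:E) by exact/measurable_EFinP.
have E k : \int[distribution P (X k)]_y `|y|%:E = \int[P]_w (Z 0%N w)%:E.
  rewrite ge0_integral_distribution//=.
  rewrite (@iid_integral Z (fun x => `|x|%:E) k)//.
  by apply: eq_integral => w _; rewrite ger0_norm.
transitivity (\int[distribution P (X i)]_x (`|x|%:E * \int[P]_w (Z 0%N w)%:E)).
  apply: eq_integral => x _; rewrite /fubini_F /f /=.
  under eq_integral do rewrite EFinM.
  rewrite ge0_integralZl_EFin//=; by rewrite E.
rewrite ge0_integralZr//; first by rewrite E.
by apply: integral_ge0 => w _; rewrite lee_fin.
Qed.

End pairwise_iid.

Section chebyshev_iid.
Context d (Omega : measurableType d) (R : realType) (P : probability Omega R).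
Implicit Types Z : nat -> Omega -> R.
Local Open Scope ereal_scope.

(** The sum has variance at most [n * s]: the cross terms of its second moment
    factor and cancel against the square of the mean. All integrals are kept
    nonnegative, so the variance is obtained by adding twice the square of the
    mean to both sides rather than by subtracting. *)
Lemma iid_chebyshev Z (m s : R) n (a : R) : pairwise_iid P Z ->
    (forall k w, 0 <= Z k w)%R ->
    \int[P]_w (Z 0%N w)%:E = m%:E -> \int[P]_w (Z 0%N w ^+ 2)%:E = s%:E ->
    (0 < a)%R ->
  P [set w | (a <= `|\sum_(i < n) Z i w - n%:R * m|)%R] <=
    (n%:R * s / a ^+ 2)%:E.
Proof.
move=> iidZ Z0 Em Es a0; have [mZ lZ iZ] := iidZ.
have Ei k : \int[P]_w (Z k w)%:E = m%:E.
  have := @iid_integral _ _ _ P Z (fun x => `|x|%:E) k iidZ.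
  have -> : \int[P]_w `|Z k w|%:E = \int[P]_w (Z k w)%:E.
    by apply: eq_integral => w _; rewrite ger0_norm.
  have -> : \int[P]_w `|Z 0%N w|%:E = \int[P]_w (Z 0%N w)%:E.
    by apply: eq_integral => w _; rewrite ger0_norm.
  rewrite Em; apply.
  - by apply/measurable_EFinP; exact: normr_measurable.
  - by move=> x; rewrite lee_fin.
have Ess k : \int[P]_w (Z k w ^+ 2)%:E = s%:E.
  rewrite -Es; apply: (@iid_integral _ _ _ P Z (fun x => (x ^+ 2)%:E) k iidZ).
  - by apply/measurable_EFinP; exact: measurable_funX.
  - by move=> x; rewrite lee_fin sqr_ge0.
have m0 : (0 <= m)%R.
  by rewrite -lee_fin -Em; apply: integral_ge0 => w _; rewrite lee_fin.
have s0 : (0 <= s)%R.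
  by rewrite -lee_fin -Es; apply: integral_ge0 => w _; rewrite lee_fin sqr_ge0.
pose S w := (\sum_(i < n) Z i w)%R.
have mS : measurable_fun setT S by apply: measurable_sum => i; exact: mZ.
have S0 w : (0 <= S w)%R by apply: sumr_ge0.
have ES : \int[P]_w (S w)%:E = (n%:R * m)%:E.
  under eq_integral do rewrite /S -sumEFin.
  rewrite ge0_integral_sum//.
  - under eq_bigr do rewrite Ei.
    by rewrite sumEFin sumr_const card_ord mulr_natl.
  - by move=> i; apply/measurable_EFinP.
  - by move=> i w _; rewrite lee_fin.
have ES2 : \int[P]_w (S w ^+ 2)%:E <= (n%:R * s + (n%:R * m) ^+ 2)%:E.
  have SE w : (S w ^+ 2 = \sum_(i < n) \sum_(j < n) Z i w * Z j w)%R.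
    by rewrite /S expr2 big_distrlr.
  under eq_integral.
    move=> w _; rewrite SE -sumEFin.
    under eq_bigr do rewrite -sumEFin.
    over.
  have mZZ i j : measurable_fun setT (fun w => (Z i w * Z j w)%:E).
    by apply/measurable_EFinP; exact: measurable_funM.
  have mZZs (i : 'I_n) : measurable_fun setT (fun w => \sum_(j < n) (Z i w * Z j w)%:E).
    by apply: emeasurable_sum => j.
  have ZZs0 (i : 'I_n) w : setT w -> 0 <= \sum_(j < n) (Z i w * Z j w)%:E.
    by move=> _; apply: sume_ge0 => j _; rewrite lee_fin mulr_ge0.
  rewrite ge0_integral_sum//.
  have H (i j : 'I_n) :
      \int[P]_w (Z i w * Z j w)%:E <= ((if j == i then s else 0) + m ^+ 2)%:E.
    case: eqVneq => [->|ij].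
      under eq_integral do rewrite -expr2.
      by rewrite Ess lee_fin lerDl sqr_ge0.
    rewrite iid_integralM// 1?eq_sym// Em -EFinM add0r expr2 lee_fin//.
  apply: (@le_trans _ _ (\sum_(i < n) \sum_(j < n)
            ((if j == i then s else 0) + m ^+ 2)%:E)).
    apply: lee_sum => i _; rewrite ge0_integral_sum//.
    - by apply: lee_sum => j _; exact: H.
    - by move=> j w _; rewrite lee_fin mulr_ge0.
  under eq_bigr do rewrite sumEFin.
  rewrite sumEFin lee_fin.
  under eq_bigr do rewrite big_split /= -big_mkcond big_pred1_eq sumr_const card_ord.
  rewrite big_split/= !sumr_const !card_ord -(mulr_natl s)
    -(mulr_natl (_ *+ n)) -(mulr_natl (m ^+ 2)).
  by rewrite le_eqVlt; apply/orP; left; apply/eqP; ring.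
pose D w := (S w - n%:R * m)%R.
have mD : measurable_fun setT D by apply: measurable_funB.
have ED2 : \int[P]_w (D w ^+ 2)%:E <= (n%:R * s)%:E.
  have mD2 : measurable_fun setT (fun w => (D w ^+ 2)%:E).
    by apply/measurable_EFinP; exact: measurable_funX.
  have nm0 : (0 <= n%:R * m)%R by rewrite mulr_ge0.
  have L : \int[P]_w (D w ^+ 2)%:E + (2 * (n%:R * m) ^+ 2)%:E =
           \int[P]_w (S w ^+ 2)%:E + ((n%:R * m) ^+ 2)%:E.
    transitivity (\int[P]_w ((D w ^+ 2)%:E + (2 * (n%:R * m))%:E * (S w)%:E)).
      rewrite ge0_integralD//.
      - rewrite ge0_integralZl_EFin// ?mulr_ge0//.
        + by rewrite ES -EFinM expr2 mulrA.
        + by move=> w _; rewrite lee_fin.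
        + exact/measurable_EFinP.
      - by move=> w _; rewrite lee_fin sqr_ge0.
      - by move=> w _; rewrite -EFinM lee_fin !mulr_ge0.
      - by apply/measurable_EFinP; exact: measurable_funM.
    transitivity (\int[P]_w ((S w ^+ 2)%:E + ((n%:R * m) ^+ 2)%:E)).
      apply: eq_integral => w _; rewrite -EFinM -!EFinD /D; congr EFin; ring.
    rewrite ge0_integralD//.
    - by congr (_ + _); have := expectation_cst P ((n%:R * m) ^+ 2); rewrite unlock.
    - by move=> w _; rewrite lee_fin sqr_ge0.
    - by apply/measurable_EFinP; exact: measurable_funX.
    - by move=> w _; rewrite lee_fin sqr_ge0.
  rewrite -(@leeD2rE _ (2 * (n%:R * m) ^+ 2)%:E)// L.
  apply: (le_trans (leeD2r _ ES2)).
  by rewrite -!EFinD lee_fin le_eqVlt; apply/orP; left; apply/eqP; ring.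
pose X : {mfun Omega >-> R} := HB.pack D (isMeasurableFun.Build _ _ _ _ _ mD).
have a20 : (0 < a ^+ 2)%R by rewrite exprn_gt0.
rewrite EFinM lee_pdivlMr// muleC.
have := @markov _ _ _ P X (fun x => x ^+ 2)%R a a0.
have mX2 : measurable_fun setT (fun x : R => x ^+ 2)%R by apply: measurable_funX.
have X20 (r : R) : (0 <= r -> 0 <= r ^+ 2)%R by move=> _; exact: sqr_ge0.
have X2h : {in Num.nneg &, {homo (fun x : R => x ^+ 2)%R : x y / (x <= y)%R}}.
  by move=> x y; rewrite !nnegrE => x0 y0; rewrite ler_sqr.
move=> /(_ mX2 X20 X2h)/le_trans; apply.
rewrite unlock (le_trans _ ED2)//.
rewrite le_eqVlt; apply/orP; left; apply/eqP.
by apply: eq_integral => w _ /=; rewrite real_normK// num_real.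
Qed.

End chebyshev_iid.

(** * Strong laws of large numbers *)

Section bounded_lln.
Context d (Omega : measurableType d) (R : realType) (P : probability Omega R).
Implicit Types Z : nat -> Omega -> R.

Lemma borel_cantelli_ae (A : nat -> set Omega) (p : nat -> R) (C : R) :
    (forall k, measurable (A k)) -> (forall k, (P (A k) <= (p k)%:E)%E) ->
    (forall n, \sum_(0 <= k < n) p k <= C) ->
  {ae P, forall w, \forall k \near \oo, ~ A k w}.
Proof.
move=> mA pA pC; exists (lim_sup_set A); split.
- apply: bigcap_measurable => // k _; exact: bigcup_measurable.
- apply: lim_sup_set_cvg0 => //; apply: (@le_lt_trans _ _ C%:E); last exact: ltry.
  apply: lime_le; first exact: is_cvg_nneseries.
  apply: nearW => n; apply: (@le_trans _ _ (\sum_(0 <= k < n) (p k)%:E)%E).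
    by apply: lee_sum => k _; exact: pA.
  by rewrite sumEFin lee_fin.
- move=> w /= nH n _; apply: contrapT => nA; apply: nH.
  by exists n => // k /= nk Akw; apply: nA; exists k.
Qed.

Lemma sum_inv_sqr_le n : \sum_(0 <= k < n) (k.+1%:R ^- 2 : R) <= 2.
Proof.
case: n => [|n]; first by rewrite big_geq.
suff: \sum_(0 <= k < n.+1) (k.+1%:R ^- 2 : R) <= 2 - n.+1%:R^-1.
  by move=> /le_trans; apply; rewrite gerBl invr_ge0.
elim: n => [|n ih]; first by rewrite big_nat1 expr1n invr1; lra.
rewrite big_nat_recr//=; apply: (le_trans (lerD ih (lexx _))).
have n1 : (0 : R) < n.+1%:R by rewrite ltr0n.
rewrite -[n.+2%:R]natr1.
set x : R := n.+1%:R in n1 *.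
rewrite -subr_ge0.
have -> : 2 - (x + 1)^-1 - (2 - x^-1 + (x + 1) ^- 2) = (x * (x + 1) ^+ 2)^-1.
  by field; lra.
by rewrite invr_ge0; nra.
Qed.

Lemma ge0_le_integral_EFin (f g : Omega -> R) :
    measurable_fun setT f -> measurable_fun setT g ->
    (forall w, 0 <= f w) -> (forall w, f w <= g w) ->
  (\int[P]_w (f w)%:E <= \int[P]_w (g w)%:E)%E.
Proof.
move=> mf mg f0 fg; apply: ge0_le_integral => [//|w _|||w _].
- by rewrite lee_fin.
- exact/measurable_EFinP.
- exact/measurable_EFinP.
- by rewrite lee_fin.
Qed.

Lemma bounded_integral_fin_num (f : Omega -> R) (M : R) :
    measurable_fun setT f -> (forall w, 0 <= f w <= M) ->
  (\int[P]_w (f w)%:E)%E \is a fin_num.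
Proof.
move=> mf fM; rewrite ge0_fin_numE; last first.
  by apply: integral_ge0 => w _; rewrite lee_fin; case/andP: (fM w).
apply: (@le_lt_trans _ _ (\int[P]_w (cst M w)%:E)%E).
  by apply: ge0_le_integral_EFin => // w; case/andP: (fM w).
have := expectation_cst P M; rewrite unlock => ->; exact: ltry.
Qed.

Lemma ler_sum_widen (x : nat -> R) k n : (forall i, 0 <= x i) -> (k <= n)%N ->
  \sum_(i < k) x i <= \sum_(i < n) x i.
Proof.
move=> x0 kn; rewrite -!(big_mkord xpredT x) (big_cat_nat (leq0n k) kn)/=.
by rewrite lerDl sumr_ge0.
Qed.

(** Along the squares, the bounds of [iid_chebyshev] are summable, so there the sum
    is eventually at least [b] times the number of terms, where [c < b] is halfway
    to the mean. Between consecutive squares the sum can only grow, while the ratio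
    of consecutive squares tends to 1, which absorbs the passage from [b] to [c]. *)
Lemma lln_bounded_lower Z (M c : R) : pairwise_iid P Z ->
    (forall k w, 0 <= Z k w <= M) -> (c%:E < \int[P]_w (Z 0%N w)%:E)%E ->
  {ae P, forall w, \forall N \near \oo, c * N%:R < \sum_(i < N) Z i w}.
Proof.
move=> iidZ ZM; have Z0 k w : 0 <= Z k w by case/andP: (ZM k w).
have [mZ _ _] := iidZ.
have finZ : (\int[P]_w (Z 0%N w)%:E)%E \is a fin_num.
  exact: (@bounded_integral_fin_num (Z 0%N) M).
have finZ2 : (\int[P]_w (Z 0%N w ^+ 2)%:E)%E \is a fin_num.
  apply: (@bounded_integral_fin_num (fun w => Z 0%N w ^+ 2) (M ^+ 2)) => [|w].
    exact: measurable_funX.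
  have /andP[Zw0 ZwM] := ZM 0%N w.
  by rewrite sqr_ge0 lerXn2r// nnegrE (le_trans Zw0).
set m := fine (\int[P]_w (Z 0%N w)%:E)%E.
set s := fine (\int[P]_w (Z 0%N w ^+ 2)%:E)%E.
rewrite -(fineK finZ) -/m lte_fin => cm.
have s0 : 0 <= s by apply: fine_ge0; apply: integral_ge0 => w _; rewrite lee_fin sqr_ge0.
have m0 : 0 <= m by apply: fine_ge0; apply: integral_ge0 => w _; rewrite lee_fin.
have S0 N w : 0 <= \sum_(i < N) Z i w by apply: sumr_ge0.
have [c0|c0] := ltP c 0.
  apply/aeW => w; exists 1%N => // N /= N0.
  by apply: (lt_le_trans _ (S0 N w)); rewrite pmulr_llt0// ltr0n.
pose b := (m + c) / 2.
pose e := (m - c) / 2.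
have e0 : 0 < e by rewrite /e; lra.
have cb : c < b by rewrite /b; lra.
pose q k := (k.+1 ^ 2)%N.
pose A k := [set w | (e * (q k)%:R <= `|\sum_(i < q k) Z i w - (q k)%:R * m|)%R].
have q0 k : (0 : R) < (q k)%:R by rewrite ltr0n expn_gt0.
have mA k : measurable (A k).
  rewrite -[A k]setTI; apply: measurable_fun_le => //.
  apply: measurableT_comp => //; apply: measurable_funB => //.
  exact: measurable_sum.
have PA k : (P (A k) <= (s / e ^+ 2 * k.+1%:R ^- 2)%:E)%E.
  have := @iid_chebyshev _ _ _ P Z m s (q k) (e * (q k)%:R) iidZ Z0.
  rewrite /m /s !fineK// => /(_ erefl erefl (mulr_gt0 e0 (q0 k)))/le_trans; apply.
  rewrite lee_fin -/m -/s le_eqVlt; apply/orP; left; apply/eqP.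
  have : (0 : R) < k.+1%:R by rewrite ltr0n.
  rewrite /q natrX; set x : R := k.+1%:R => x0.
  by field; rewrite !gt_eqF.
have sumA n : \sum_(0 <= k < n) (s / e ^+ 2 * k.+1%:R ^- 2) <= s / e ^+ 2 * 2.
  by rewrite -mulr_sumr ler_wpM2l ?sum_inv_sqr_le// divr_ge0// sqr_ge0.
have := borel_cantelli_ae mA PA sumA; apply: filterS => w [K _ HK].
(* With [3 * c <= (b - c) * k], one has [c * (k + 2) ^ 2 <= b * (k + 1) ^ 2],
   since [(k + 2) ^ 2 <= (k + 1) ^ 2 + 3 * (k + 1)]. *)
have [L HL] : exists L : nat, 3 * c <= (b - c) * L%:R.
  exists (Num.truncn (3 * c / (b - c))).+1; rewrite [leRHS]mulrC -ler_pdivrMr ?subr_gt0//.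
  by rewrite ltW// truncnS_gt.
pose K' := maxn K L.
exists (q K') => // N /= qN.
have [k [kK kN Nk]] : exists k, [/\ (K' <= k)%N, (q k <= N)%N & (N < q k.+1)%N].
  have ex : exists k, (q k <= N)%N by exists K'.
  have ub k : (q k <= N)%N -> (k <= N)%N.
    by apply: leq_trans; rewrite (leq_trans (leqnSn k))// leq_pmulr.
  case: (ex_maxnP ex ub) => k kN kmax; exists k; split => //; first exact: kmax.
  by rewrite ltnNge; apply/negP => /kmax; rewrite ltnn.
have := HK k (leq_trans (leq_maxl _ _) kK).
rewrite /A /= => /negP; rewrite -ltNge ltr_norml => /andP[low _].
have Sk : b * (q k)%:R < \sum_(i < q k) Z i w.
  have -> : b = m - e by rewrite /b /e; field.
  by rewrite mulrBl; lra.
have SN : \sum_(i < q k) Z i w <= \sum_(i < N) Z i w.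
  exact: (@ler_sum_widen (Z^~ w)).
apply: (lt_le_trans _ SN); apply: (le_lt_trans _ Sk).
have kL : L%:R <= k%:R :> R by rewrite ler_nat (leq_trans _ kK)// leq_maxr.
have Nq : N%:R <= (k%:R + 2) ^+ 2 :> R.
  by rewrite -[2]/(2%:R) -natrD -natrX ler_nat addn2 ltnW.
have -> : (q k)%:R = (k%:R + 1) ^+ 2 :> R by rewrite /q natrX natr1.
apply: (le_trans (ler_wpM2l c0 Nq)).
have k0 : (0 : R) <= k%:R by [].
have : (b - c) * L%:R <= (b - c) * k%:R by rewrite ler_wpM2l// subr_ge0 ltW.
nra.
Qed.

End bounded_lln.

Section integrable_lln.
Context d (Omega : measurableType d) (R : realType) (P : probability Omega R).
Implicit Types Z : nat -> Omega -> R.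

(** The sum is geometric from the first power of two above [x] on. The bound
    needed for the induction keeps track of the tail of that series. *)
Lemma sum_dyadic_small (x : R) n : 0 <= x ->
  \sum_(0 <= k < n) (if x <= 2 ^+ k then x else 0) ^+ 2 / 2 ^+ k <= 2 * x.
Proof.
move=> x0.
have e2 k : (0 : R) < 2 ^+ k by rewrite exprn_gt0.
have : \sum_(0 <= k < n) (if x <= 2 ^+ k then x else 0) ^+ 2 / 2 ^+ k <=
    (if x <= 2 ^+ n then 2 * x - 2 * x ^+ 2 / 2 ^+ n else 0).
  elim: n => [|n ih].
    rewrite big_geq// expr0; case: ifPn => // x1; nra.
  rewrite big_nat_recr//=; apply: (le_trans (lerD ih (lexx _))).
  have := e2 n; rewrite [2 ^+ n.+1]exprS; set y : R := 2 ^+ n => y0.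
  case: (leP x y) => xy.
    have -> : x <= 2 * y by nra.
    by rewrite le_eqVlt; apply/orP; left; apply/eqP; field; rewrite gt_eqF.
  rewrite expr0n/= mul0r addr0; case: ifPn => // x2.
  have -> : 2 * x - 2 * x ^+ 2 / (2 * y) = x * (2 * y - x) / y.
    by field; rewrite gt_eqF.
  by rewrite divr_ge0 ?mulr_ge0// ?subr_ge0// ltW.
move=> /le_trans; apply; case: ifPn => _; last by rewrite mulr_ge0.
by rewrite gerBl divr_ge0 ?mulr_ge0 ?sqr_ge0// ltW.
Qed.

(** The sum is geometric up to the last power of two below [x]. *)
Lemma sum_dyadic_large (x : R) n : 0 <= x ->
  \sum_(0 <= k < n) 2 ^+ k * (2 ^+ k < x)%R%:R <= 2 * x.
Proof.
move=> x0.
have e2 k : (0 : R) < 2 ^+ k by rewrite exprn_gt0.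
suff : \sum_(0 <= k < n) 2 ^+ k * (2 ^+ k < x)%R%:R <= Num.min (2 ^+ n) (2 * x).
  by rewrite le_min => /andP[].
elim: n => [|n ih]; first by rewrite big_geq// le_min expr0 ler01 mulr_ge0.
rewrite big_nat_recr//=; move: ih; rewrite !le_min => /andP[ih1 ih2].
have := e2 n; rewrite [2 ^+ n.+1]exprS; move: ih1; set y : R := 2 ^+ n => ih1 y0.
case: (ltP y x) => xy /=; rewrite ?mulr1 ?mulr0; apply/andP; split; lra.
Qed.

(** A strong law up to the constant 4, enough to control the part of an integrable
    variable left over by a truncation. On the block of length [2 ^ n], cut the
    variables at height [2 ^ n]. The deviation probabilities of the truncated sums
    and the probabilities that some variable exceeds the height are both summable,
    because the two dyadic series above are bounded by twice the variable. Outside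
    these events the sum over the block is at most [2 * e * 2 ^ n]; monotonicity in
    the number of terms, from one power of two to the next, doubles the constant. *)
Lemma lln_coarse_upper Z (e : R) : pairwise_iid P Z ->
    (forall k w, 0 <= Z k w) -> 0 < e -> (\int[P]_w (Z 0%N w)%:E <= e%:E)%E ->
  {ae P, forall w, \forall N \near \oo, \sum_(i < N) Z i w <= 4 * e * N%:R}.
Proof.
move=> iidZ Z0 e0 Ee; have [mZ lZ iZ] := iidZ.
pose g n (x : R) := if x <= 2 ^+ n then x else 0.
have mg n : measurable_fun setT (g n).
  apply: measurable_fun_ifT => //; exact: measurable_fun_ler.
pose Y n i := g n \o Z i.
have iidY n : pairwise_iid P (Y n) by exact: pairwise_iid_comp.
have e2 k : (0 : R) < 2 ^+ k by rewrite exprn_gt0.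
have Y0 n k w : 0 <= Y n k w by rewrite /Y /g /=; case: ifP.
have Y2 n k w : Y n k w <= 2 ^+ n by rewrite /Y /g /=; case: ifPn => // _; exact: ltW.
have YZ n k w : Y n k w <= Z k w by rewrite /Y /g /=; case: ifP.
have mY n k : measurable_fun setT (Y n k) by exact: measurableT_comp.
pose m n := fine (\int[P]_w (Y n 0%N w)%:E)%E.
pose s n := fine (\int[P]_w (Y n 0%N w ^+ 2)%:E)%E.
have mE n : (\int[P]_w (Y n 0%N w)%:E = (m n)%:E)%E.
  rewrite fineK//; apply: (@bounded_integral_fin_num _ _ _ P _ (2 ^+ n)) => // w.
  by rewrite Y0 Y2.
have sE n : (\int[P]_w (Y n 0%N w ^+ 2)%:E = (s n)%:E)%E.
  rewrite fineK//; apply: (@bounded_integral_fin_num _ _ _ P _ ((2 ^+ n) ^+ 2)) => [|w].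
    exact: measurable_funX.
  by rewrite sqr_ge0/=; have := Y0 n 0%N w; have := Y2 n 0%N w; nra.
have me n : m n <= e.
  rewrite -lee_fin -mE; apply: (le_trans _ Ee).
  exact: ge0_le_integral_EFin.
(* [A n]: the truncated sum deviates from its mean.
   [B n]: the truncation has changed a term of the block. *)
pose q n := (2 ^ n)%N.
have qE n : (q n)%:R = 2 ^+ n :> R by rewrite natrX.
pose A n := [set w | e * 2 ^+ n <= `|\sum_(i < q n) Y n i w - (q n)%:R * m n|].
pose B n := [set w | exists2 i, (i < q n)%N & 2 ^+ n < Z i w].
have mA k : measurable (A k).
  rewrite -[A k]setTI; apply: measurable_fun_le => //.
  apply: measurableT_comp => //; apply: measurable_funB => //.
  exact: measurable_sum.
have mlt i n : measurable [set w | 2 ^+ n < Z i w].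
  rewrite -[X in measurable X](_ : Z i @^-1` `]2 ^+ n, +oo[%classic = _).
    by rewrite -[X in measurable X]setTI; exact: mZ.
  by apply/seteqP; split => w /=; rewrite in_itv/= andbT.
have BE n : B n = \big[setU/set0]_(i < q n) [set w | 2 ^+ n < Z i w].
  rewrite -(bigcup_mkord _ (fun i => [set w | 2 ^+ n < Z i w])).
  by apply/seteqP; split => w [i iq Zi]; exists i.
have mB n : measurable (B n) by rewrite BE; apply: bigsetU_measurable.
have PA n : (P (A n) <= (s n / 2 ^+ n / e ^+ 2)%:E)%E.
  have := @iid_chebyshev _ _ _ P (Y n) (m n) (s n) (q n) (e * 2 ^+ n) (iidY n) (Y0 n)
    (mE n) (sE n) (mulr_gt0 e0 (e2 n)).
  move=> /le_trans; apply; rewrite lee_fin le_eqVlt; apply/orP; left; apply/eqP.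
  have := e2 n; rewrite qE; set x : R := 2 ^+ n => x0.
  by field; rewrite !gt_eqF.
have sumA n : \sum_(0 <= k < n) (s k / 2 ^+ k / e ^+ 2) <= 2 * e / e ^+ 2.
  rewrite -mulr_suml ler_wpM2r ?invr_ge0 ?sqr_ge0//.
  rewrite -lee_fin -sumEFin.
  have E k : ((s k / 2 ^+ k)%:E = \int[P]_w (Y k 0%N w ^+ 2 / 2 ^+ k)%:E)%E.
    rewrite mulrC EFinM -sE -ge0_integralZl_EFin// ?invr_ge0 ?(ltW (e2 k))//.
    - by apply: eq_integral => w _; rewrite -EFinM mulrC.
    - by move=> w _; rewrite lee_fin sqr_ge0.
    - by apply/measurable_EFinP; exact: measurable_funX.
  under eq_bigr do rewrite E.
  have mYk k : measurable_fun setT (fun w => Y k 0%N w ^+ 2 / 2 ^+ k).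
    by apply: measurable_funM => //; exact: measurable_funX.
  have Yk0 k w : 0 <= Y k 0%N w ^+ 2 / 2 ^+ k by rewrite divr_ge0 ?sqr_ge0// ltW.
  rewrite -ge0_integral_sum//; last 2 first.
  - by move=> k; exact/measurable_EFinP.
  - by move=> k w _; rewrite lee_fin.
  apply: (@le_trans _ _ (\int[P]_w (2 * Z 0%N w)%:E)%E).
    under eq_integral do rewrite sumEFin.
    apply: ge0_le_integral_EFin => [|||w].
    - exact: measurable_sum.
    - exact: measurable_funM.
    - by move=> w; apply: sumr_ge0.
    - exact: sum_dyadic_small.
  under eq_integral do rewrite EFinM.
  rewrite ge0_integralZl_EFin//.
  - by rewrite EFinM lee_wpmul2l// lee_fin.
  - by move=> w _; rewrite lee_fin.
  - exact/measurable_EFinP.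
pose t n := fine (P [set w | (2 ^+ n < Z 0%N w)%R]).
have tE n : (P [set w | (2 ^+ n < Z 0%N w)%R] = (t n)%:E)%E by rewrite fineK// fin_num_measure.
have PB n : (P (B n) <= (2 ^+ n * t n)%:E)%E.
  rewrite BE; apply: (le_trans
    (@Boole_inequality _ _ _ P (fun i => [set w | (2 ^+ n < Z i w)%R]) _ _)) => //.
  have E i : P [set w | (2 ^+ n < Z i w)%R] = (t n)%:E.
    have H k : [set w | 2 ^+ n < Z k w] = Z k @^-1` `]2 ^+ n, +oo[%classic.
      by apply/seteqP; split => w /=; rewrite in_itv/= andbT.
    by rewrite -tE !H lZ.
  rewrite (eq_bigr (fun=> (t n)%:E)) => [|i _]; last exact: E.
  by rewrite sumEFin sumr_const card_ord -qE mulr_natl.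
have indE k : (fun w => (2 ^+ k < Z 0%N w)%R%:R : R) = \1_[set w | (2 ^+ k < Z 0%N w)%R].
  apply/funext => w; rewrite indicE; congr (_%:R).
  case: (ltP (2 ^+ k) (Z 0%N w)) => h; first by rewrite mem_set.
  by rewrite memNset//=; apply/negP; rewrite -leNgt.
have sumB n : \sum_(0 <= k < n) (2 ^+ k * t k) <= 2 * e.
  rewrite -lee_fin -sumEFin.
  have E k : ((2 ^+ k * t k)%:E = \int[P]_w (2 ^+ k * (2 ^+ k < Z 0%N w)%R%:R)%:E)%E.
    rewrite EFinM -tE -[LHS]/((2 ^+ k)%:E * _)%E.
    have -> : P [set w | (2 ^+ k < Z 0%N w)%R] =
       (\int[P]_w (\1_[set w | (2 ^+ k < Z 0%N w)%R] w)%:E)%E.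
      by rewrite integral_indic// setIT.
    rewrite -ge0_integralZl_EFin// ?(ltW (e2 k))//.
    - by apply: eq_integral => w _; rewrite -EFinM -(congr1 (@^~ w) (indE k)).
    - by apply/measurable_EFinP.
  under eq_bigr do rewrite E.
  have mYk k : measurable_fun setT (fun w => 2 ^+ k * (2 ^+ k < Z 0%N w)%R%:R : R).
    apply: measurable_funM => //.
    rewrite indE.
    exact: measurable_indic.
  have Yk0 k w : 0 <= 2 ^+ k * (2 ^+ k < Z 0%N w)%R%:R :> R by rewrite mulr_ge0// ltW.
  rewrite -ge0_integral_sum//; last first.
  - by move=> k; exact/measurable_EFinP.
  apply: (@le_trans _ _ (\int[P]_w (2 * Z 0%N w)%:E)%E).
    under eq_integral do rewrite sumEFin.
    apply: ge0_le_integral_EFin => [|||w].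
    - exact: measurable_sum.
    - exact: measurable_funM.
    - by move=> w; apply: sumr_ge0.
    - exact: sum_dyadic_large.
  under eq_integral do rewrite EFinM.
  rewrite ge0_integralZl_EFin//.
  - by rewrite EFinM lee_wpmul2l// lee_fin.
  - by move=> w _; rewrite lee_fin.
  - exact/measurable_EFinP.
have aeA := borel_cantelli_ae mA PA sumA.
have aeB := borel_cantelli_ae mB PB sumB.
near=> w.
have [K _ HK] : \forall k \near \oo, ~ A k w by near: w.
have [L _ HL] : \forall k \near \oo, ~ B k w by near: w.
exists (q (maxn K L)) => // N /= qN.
have N0 : (0 < N)%N by rewrite (leq_trans _ qN)// expn_gt0.
have := trunc_logP (isT : (1 < 2)%N) N0; have := @trunc_log_ltn 2 N isT.
set k := trunc_log 2 N => Nk kN.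
have kmax : (maxn K L <= k.+1)%N.
  by rewrite -(@leq_exp2l 2)// (leq_trans qN)// ltnW.
have nB := HL k.+1 (leq_trans (leq_maxr _ _) kmax).
have := HK k.+1 (leq_trans (leq_maxl _ _) kmax).
rewrite /A /= => /negP; rewrite -ltNge ltr_norml => /andP[_ up].
have ZY (i : nat) : (i < q k.+1)%N -> Z i w = Y k.+1 i w.
  move=> iq; rewrite /Y /g /=; case: ifPn => //; rewrite -ltNge => h.
  by exfalso; apply: nB; exists i.
have SZ : \sum_(i < q k.+1) Z i w <= 2 * e * 2 ^+ k.+1.
  under eq_bigr do rewrite ZY//.
  have := me k.+1; move: up; rewrite qE; have := e2 k.+1.
  by set x : R := 2 ^+ k.+1; nra.
have : \sum_(i < N) Z i w <= \sum_(i < q k.+1) Z i w.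
  by apply: (@ler_sum_widen _ (Z^~ w)) => //; exact: ltnW.
move=> /le_trans; apply; apply: (le_trans SZ).
have : 2 ^+ k <= N%:R :> R by rewrite -natrX ler_nat.
by rewrite exprS; nra.
Unshelve. all: by end_near. Qed.

(** Cut the variables at a height [n] losing less than [e] of the mean. The sums of
    the cut variables are controlled from above by applying [lln_bounded_lower] to
    the bounded variables [n - min Z n], and the sums of the remainders by
    [lln_coarse_upper]; with [e] a fifth of the gap between [c] and the mean, the
    errors [e] and [4 * e] fit into the gap. *)
Lemma lln_upper Z (c : R) : pairwise_iid P Z ->
    (forall k w, 0 <= Z k w) -> (\int[P]_w (Z 0%N w)%:E < c%:E)%E ->
  {ae P, forall w, \forall N \near \oo, \sum_(i < N) Z i w < c * N%:R}.
Proof.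
move=> iidZ Z0 Zc; have [mZ lZ iZ] := iidZ.
have mZE : measurable_fun setT (fun w => (Z 0%N w)%:E) by exact/measurable_EFinP.
have finZ : (\int[P]_w (Z 0%N w)%:E)%E \is a fin_num.
  rewrite ge0_fin_numE; first exact: (lt_trans Zc (ltry _)).
  by apply: integral_ge0 => w _; rewrite lee_fin.
set m := fine (\int[P]_w (Z 0%N w)%:E)%E.
have mE : (\int[P]_w (Z 0%N w)%:E = m%:E)%E by rewrite fineK.
move: Zc; rewrite mE lte_fin => mc.
pose e := (c - m) / 5.
have e0 : 0 < e by rewrite /e; lra.
pose g n (x : R) := Num.min x n%:R.
have mg n : measurable_fun setT (g n) by exact: measurable_minr.
have g0 n x : 0 <= x -> 0 <= g n x by move=> x0; rewrite le_min x0 ler0n.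
have [n yn] : exists n, ((m - e)%:E < \int[P]_w (g n (Z 0%N w))%:E)%E.
  have mgZ n : measurable_fun setT (fun w => g n (Z 0%N w)).
    exact: measurableT_comp.
  have : ((\int[P]_w (g n (Z 0%N w))%:E)%E @[n --> \oo] --> m%:E).
    have -> : (m%:E = \int[P]_w limn (fun n => (g n (Z 0%N w))%:E))%E.
      rewrite -mE; apply: eq_integral => w _; apply/esym/cvg_lim => //.
      apply: cvg_near_cst; exists (Num.truncn (Z 0%N w)).+1 => // n /= nZ.
      congr EFin; apply/min_idPl; apply: (le_trans (ltW (truncnS_gt _))).
      by rewrite ler_nat.
    apply: cvg_monotone_convergence => //.
    - by move=> n; exact/measurable_EFinP.
    - by move=> n w _; rewrite lee_fin g0.
    - move=> w _ a b ab; rewrite lee_fin /g le_min !ge_min lexx/=.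
      by rewrite ler_nat ab orbT.
  move=> cv; apply: contrapT => /forallNP H.
  have /(lime_le (cvgP _ cv)) : \forall n \near \oo,
      (\int[P]_w (g n (Z 0%N w))%:E <= (m - e)%:E)%E.
    by apply: nearW => n; rewrite leNgt; apply/negP/H.
  by rewrite (cvg_lim _ cv)// lee_fin; lra.
pose Y i := g n \o Z i.
pose T i := (fun x => x - g n x) \o Z i.
pose V i := (fun x => n%:R - g n x) \o Z i.
have iidT : pairwise_iid P T.
  by apply: pairwise_iid_comp => //; apply: measurable_funB.
have iidV : pairwise_iid P V.
  by apply: pairwise_iid_comp => //; apply: measurable_funB.
have T0 k w : 0 <= T k w by rewrite subr_ge0 ge_min lexx.
have V0 k w : 0 <= V k w <= n%:R.
  by rewrite subr_ge0 ge_min lexx orbT/= gerBl g0.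
have Y0 w : 0 <= Y 0%N w by rewrite g0.
have mY : measurable_fun setT (Y 0%N) by exact: measurableT_comp.
have finY : (\int[P]_w (Y 0%N w)%:E)%E \is a fin_num.
  apply: (@bounded_integral_fin_num _ _ _ P _ n%:R) => // w.
  by rewrite Y0 ge_min lexx orbT.
set y := fine (\int[P]_w (Y 0%N w)%:E)%E.
have yE : (\int[P]_w (Y 0%N w)%:E = y%:E)%E by rewrite fineK.
have ym : m - e < y by rewrite -lte_fin -yE.
have TE : (\int[P]_w (T 0%N w)%:E <= e%:E)%E.
  rewrite -(@leeD2rE _ y%:E)// -{1}yE -ge0_integralD//.
  - under eq_integral do rewrite -EFinD subrK.
    by rewrite mE -EFinD lee_fin; lra.
  - by move=> w _; rewrite lee_fin.
  - by apply/measurable_EFinP; case: iidT.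
  - by move=> w _; rewrite lee_fin.
  - exact/measurable_EFinP.
have VE : ((n%:R - m - e)%:E < \int[P]_w (V 0%N w)%:E)%E.
  have : (\int[P]_w (V 0%N w)%:E + \int[P]_w (Y 0%N w)%:E = n%:R%:E)%E.
    rewrite -ge0_integralD//.
    - under eq_integral do rewrite -EFinD subrK.
      by have := expectation_cst P n%:R; rewrite unlock.
    - by move=> w _; rewrite lee_fin; case/andP: (V0 0%N w).
    - by apply/measurable_EFinP; case: iidV.
    - by move=> w _; rewrite lee_fin.
    - exact/measurable_EFinP.
  have finV : (\int[P]_w (V 0%N w)%:E)%E \is a fin_num.
    by apply: (@bounded_integral_fin_num _ _ _ P _ n%:R) => //; case: iidV.
  have : y <= m.
    rewrite -lee_fin -yE -mE; apply: ge0_le_integral_EFin => // w.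
    by rewrite ge_min lexx.
  by rewrite yE -(fineK finV) -EFinD lte_fin => ym' [Vy]; lra.
have aeT := lln_coarse_upper iidT T0 e0 TE.
have aeV := lln_bounded_lower iidV V0 VE.
move: aeT aeV; apply: filterS2 => w.
apply: filterS2 => N HT HV.
have : \sum_(i < N) Z i w = \sum_(i < N) T i w + (n%:R * N%:R - \sum_(i < N) V i w).
  have -> : n%:R * N%:R = \sum_(i < N) n%:R :> R by rewrite sumr_const card_ord mulr_natr.
  rewrite -sumrB -big_split/=; apply: eq_bigr => i _.
  by rewrite /T /V /=; ring.
move=> ->; apply: (@le_lt_trans _ _ (4 * e * N%:R + (n%:R * N%:R - \sum_(i < N) V i w))).
  by rewrite lerD2r.
have -> : c = m + 5 * e by rewrite /e; field.
have : 0 <= e * N%:R by rewrite mulr_ge0// ltW.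
by move: HV; set x : R := N%:R; nra.
Qed.

End integrable_lln.

(** * Functions measurable for the completed law *)

Section completion.
Context d d' (Omega : measurableType d) (S : measurableType d') (R : realType).
Variable P : probability Omega R.
Hypothesis cP : measure_is_complete P.

Lemma measure_eq_off_null (A B N : set Omega) : measurable A -> measurable B ->
    measurable N -> P N = 0%E -> (forall w, ~ N w -> (A w <-> B w)) -> P A = P B.
Proof.
move=> mA mB mN N0 AB.
have le C D : measurable C -> measurable D -> (forall w, ~ N w -> C w -> D w) ->
    (P C <= P D)%E.
  move=> mC mD CD.
  have mDN : measurable (D `|` N) by exact: measurableU.
  apply: (@le_trans _ _ (P (D `|` N))).
    apply: le_measure; rewrite ?inE// => w Cw.
    by have [Nw|nNw] := pselect (N w); [right|left; exact: CD].
  by apply: (le_trans (measureU2 _ mD mN)); rewrite [X in (_ + X)%E]N0 adde0.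
by apply/eqP; rewrite eq_le; apply/andP; split; apply: le => // w Nw /AB; exact.
Qed.

(** Sets that agree with a measurable set off a null set form a sigma-algebra: the
    condition is symmetric under complementation, and null sets are stable under
    countable unions. *)
Lemma completed_measurable_approx (mu : {measure set S -> \bar R}) (A : set (completed mu)) :
  measurable A -> exists A0 N : set S,
    [/\ measurable A0, measurable N, mu N = 0%E & forall x, ~ N x -> (A x <-> A0 x)].
Proof.
move: A; apply: smallest_sub; last first.
  move=> _ [A0 mA0 [N [N' [mN' N'0 NN']]] <-].
  exists A0, N'; split => // x N'x; split; last by left.
  by case=> // /NN'.
split.
- by exists set0, set0; split.
- move=> A [A0 [N [mA0 mN N0 AA0]]]; exists (~` A0), N; split => //.
    exact: measurableC.
  by move=> x Nx; rewrite setTD /=; split; apply: contra_not => /(AA0 x Nx).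
- move=> F /(_ _)/cid HF.
  pose A0 n := sval (HF n).
  have HF1 n : exists N : set S, [/\ measurable (A0 n), measurable N, mu N = 0%E &
    forall x, ~ N x -> (F n x <-> A0 n x)] by exact: (svalP (HF n)).
  have HF2 n := cid (HF1 n).
  pose N n := sval (HF2 n).
  have HF3 n : [/\ measurable (A0 n), measurable (N n), mu (N n) = 0%E &
    forall x, ~ N n x -> (F n x <-> A0 n x)] := svalP (HF2 n).
  have mN n : measurable (N n) by case: (HF3 n).
  have mUN : measurable (\bigcup_n N n) by exact: bigcup_measurable.
  exists (\bigcup_n A0 n), (\bigcup_n N n); split => //.
  + by apply: bigcup_measurable => n _; case: (HF3 n).
  + apply: (measure_negligible mUN); apply: negligible_bigcup => n.
    by case: (HF3 n) => _ _ N0 _; exists (N n); split.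
  + move=> x Nx; split => -[n _ Fx]; exists n => //; have [_ _ _ h] := HF3 n.
      by apply/h => //; apply: contra_not Nx => ?; exists n.
    by apply/h => //; apply: contra_not Nx => ?; exists n.
Qed.

Variable xi : {RV P >-> S}.
Local Notation mu := (distribution P xi).

(** Variables with the law of [xi] pull null sets of that law back to null sets, and
    subsets of the latter are measurable because [P] is complete. *)
Lemma completed_preimage (X : {RV P >-> S}) (A : set (completed mu)) (A0 N : set S) :
    same_law X xi -> measurable A0 -> measurable N -> mu N = 0%E ->
    (forall x, ~ N x -> (A x <-> A0 x)) ->
  [/\ measurable (X @^-1` A), measurable (X @^-1` A0), measurable (X @^-1` N) &
      P (X @^-1` N) = 0%E].
Proof.
move=> lX mA0 mN N0 AA0.
have mX B : measurable B -> measurable (X @^-1` B).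
  by move=> mB; rewrite -[_ @^-1` _]setTI; exact: measurable_funP.
have PN : P (X @^-1` N) = 0%E by have := lX N mN; rewrite N0.
split => //; [|exact: mX|exact: mX].
have -> : X @^-1` A = (X @^-1` A0 `&` X @^-1` (~` N)) `|` (X @^-1` A `&` X @^-1` N).
  apply/seteqP; split => w /=.
    move=> Aw; have [Nw|Nw] := pselect (N (X w)); first by right.
    by left; split => //; apply/AA0.
  by move=> [[A0w Nw]|[]//]; apply/AA0.
apply: measurableU.
  by apply: measurableI; apply: mX => //; exact: measurableC.
apply: cP; exists (X @^-1` N); split => //; exact: mX.
Qed.

Lemma measurable_comp_completed (X : {RV P >-> S}) (f : completed mu -> R) :
  same_law X xi -> measurable_fun setT f -> measurable_fun setT (fun w => f (X w)).
Proof.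
move=> lX mf _ C mC; rewrite setTI.
have mfC : measurable (f @^-1` C) by rewrite -[_ @^-1` _]setTI; exact: mf.
have [A0 [N [mA0 mN N0 AA0]]] := completed_measurable_approx mfC.
by have [] := completed_preimage lX mA0 mN N0 AA0.
Qed.

Lemma same_law_comp_completed (X : {RV P >-> S}) (f : completed mu -> R) (C : set R) :
    same_law X xi -> measurable_fun setT f -> measurable C ->
  P [set w | C (f (X w))] = P [set w | C (f (xi w))].
Proof.
move=> lX mf mC.
have lxi : same_law xi xi by [].
have mfC : measurable (f @^-1` C) by rewrite -[_ @^-1` _]setTI; exact: mf.
have [A0 [N [mA0 mN N0 AA0]]] := completed_measurable_approx mfC.
have [m1 m2 m3 PN] := completed_preimage lX mA0 mN N0 AA0.
have [n1 n2 n3 QN] := completed_preimage lxi mA0 mN N0 AA0.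
have -> : P [set w | C (f (X w))] = P (X @^-1` A0).
  by apply: (measure_eq_off_null m1 m2 m3 PN) => w; exact: AA0.
have -> : P [set w | C (f (xi w))] = P (xi @^-1` A0).
  by apply: (measure_eq_off_null n1 n2 n3 QN) => w; exact: AA0.
exact: lX.
Qed.

Variable xis : nat -> {RV P >-> S}.
Hypothesis lxis : forall i, same_law (xis i) xi.
Hypothesis ixis : mutually_independent xis.

Lemma pairwise_independent (i j : nat) (A B : set S) : i != j ->
    measurable A -> measurable B ->
  P (xis i @^-1` A `&` xis j @^-1` B) = (P (xis i @^-1` A) * P (xis j @^-1` B))%E.
Proof.
move=> ij mA mB.
have := @ixis [fset i; j]%fset (fun k => if k == i then A else B).
have mAB k : measurable (if k == i then A else B) by case: ifP.
move=> /(_ mAB).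
rewrite big_fsetU1 ?inE//= big_seq_fset1 eqxx eq_sym (negbTE ij) => <-.
congr (P _); apply/seteqP; split => [w [Aw Bw] k /=|w Hw].
  rewrite !inE => /orP[]/eqP->; rewrite ?eqxx//.
  by rewrite eq_sym (negbTE ij).
split; first by have := Hw i; rewrite /= !inE eqxx; exact.
by have := Hw j; rewrite /= !inE eqxx orbT eq_sym (negbTE ij); exact.
Qed.

Lemma pairwise_iid_completed (f : completed mu -> R) :
  measurable_fun setT f -> pairwise_iid P (fun i w => f (xis i w)).
Proof.
move=> mf; split.
- by move=> i; exact: measurable_comp_completed.
- move=> i C mC; apply: (etrans (same_law_comp_completed (lxis i) mf mC)).
  exact: esym (same_law_comp_completed (lxis 0%N) mf mC).
- move=> i j C D ij mC mD.
  have mfC : measurable (f @^-1` C) by rewrite -[_ @^-1` _]setTI; exact: mf.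
  have mfD : measurable (f @^-1` D) by rewrite -[_ @^-1` _]setTI; exact: mf.
  have [A0 [N [mA0 mN N0 AA0]]] := completed_measurable_approx mfC.
  have [B0 [M [mB0 mM M0 BB0]]] := completed_measurable_approx mfD.
  have [m1 m2 m3 PN] := completed_preimage (lxis i) mA0 mN N0 AA0.
  have [n1 n2 n3 PM] := completed_preimage (lxis j) mB0 mM M0 BB0.
  have -> : P ((fun w => f (xis i w)) @^-1` C) = P (xis i @^-1` A0).
    by apply: (measure_eq_off_null m1 m2 m3 PN) => w; exact: AA0.
  have -> : P ((fun w => f (xis j w)) @^-1` D) = P (xis j @^-1` B0).
    by apply: (measure_eq_off_null n1 n2 n3 PM) => w; exact: BB0.
  rewrite -pairwise_independent//.
  apply: (@measure_eq_off_null _ _ (xis i @^-1` N `|` xis j @^-1` M)).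
  + exact: (measurableI _ _ m1 n1).
  + exact: (measurableI _ _ m2 n2).
  + exact: measurableU.
  + apply/eqP; rewrite -measure_le0 (le_trans (measureU2 _ m3 n3))//.
    by rewrite [X in (X + _)%E]PN [X in (_ + X)%E]PM adde0.
  + move=> w /= /not_orP[Nw Mw].
    by have := AA0 _ Nw; have := BB0 _ Mw; rewrite /preimage/= => -> ->.
Qed.

Lemma integral_comp_completed (f : completed mu -> R) i :
    measurable_fun setT f -> (forall x, 0 <= f x) ->
  (\int[P]_w (f (xis i w))%:E = \int[P]_w (f (xi w))%:E)%E.
Proof.
move=> mf f0.
have E : (\int[P]_w `|f (xis i w)|%:E = \int[P]_w `|f (xi w)|%:E)%E.
  apply: (@same_law_integral _ _ _ P (fun w => f (xis i w)) (fun w => f (xi w))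
    (fun x => `|x|%:E)).
  - exact: measurable_comp_completed.
  - exact: measurable_comp_completed.
  - by move=> C mC; exact: (same_law_comp_completed (lxis i) mf mC).
  - by apply/measurable_EFinP; exact: normr_measurable.
  - by move=> x; rewrite lee_fin.
have N (X : Omega -> S) : (\int[P]_w (f (X w))%:E = \int[P]_w `|f (X w)|%:E)%E.
  by apply: eq_integral => w _; rewrite ger0_norm.
by rewrite !N.
Qed.

End completion.

(** * Almost sure lower bounds of sample means on neighbourhoods *)

Section separable_balls.
Context (R : realType) (W : normedModType R).

Lemma separable_sequence : separable W ->
  exists q : nat -> W, forall v (e : R), 0 < e -> exists j, ball v e (q j).
Proof.
move=> [D cD dD]; have [f finj] := countable_injP _ cD.
exists (fun n => xget 0 [set x | D x /\ f x = n]) => v e e0.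
have [z [Dz vz]] : exists z, D z /\ ball v e z.
  have [|z [vz Dz]] := dD (ball v e) _ (ball_open v e).
    by exists v; exact: ballxx.
  by exists z.
exists (f z); case: xgetP => [x _ [Dx /finj ->]|/(_ z)]; rewrite ?inE//.
by move=> []; split.
Qed.

End separable_balls.

Section epi_liminf.
Context d d' (Omega : measurableType d) (S : measurableType d') (R : realType).
Variable P : probability Omega R.
Hypothesis cP : measure_is_complete P.
Variables (xi : {RV P >-> S}) (xis : nat -> {RV P >-> S}).
Hypothesis lxis : forall i, same_law (xis i) xi.
Hypothesis ixis : mutually_independent xis.
Local Notation mu := (distribution P xi).

(** A countable set of levels below the mean suffices, so the exceptional null set
    can be chosen independently of the level. *)
Lemma lln_bounded_lower_all (Z : nat -> Omega -> R) (M : R) : pairwise_iid P Z ->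
    (forall k w, 0 <= Z k w <= M) ->
  {ae P, forall w, forall c : R, (c%:E < \int[P]_w (Z 0%N w)%:E)%E ->
    \forall N \near \oo, c * N%:R < \sum_(i < N) Z i w}.
Proof.
move=> iidZ ZM; have [mZ _ _] := iidZ.
have finZ : (\int[P]_w (Z 0%N w)%:E)%E \is a fin_num.
  exact: (@bounded_integral_fin_num _ _ _ P (Z 0%N) M).
set m := fine (\int[P]_w (Z 0%N w)%:E)%E.
have mE : (\int[P]_w (Z 0%N w)%:E = m%:E)%E by rewrite fineK.
have H n : {ae P, forall w, \forall N \near \oo,
    (m - n.+1%:R^-1) * N%:R < \sum_(i < N) Z i w}.
  apply: (lln_bounded_lower iidZ ZM).
  by rewrite mE lte_fin ltrBlDr ltrDl invr_gt0.
move: (ae_foralln H); apply: filterS => w Hw c; rewrite mE lte_fin => cm.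
have mc0 : 0 < m - c by rewrite subr_gt0.
have [n _ /(_ n (leqnn n))/= nmc] := near_infty_natSinv_lt (PosNum mc0).
move: (Hw n); apply: filterS => N; apply: le_lt_trans.
by rewrite ler_wpM2r// lerBrDr addrC -lerBrDr ltW.
Qed.

Variables (W : normedModType R) (C : set W) (f : W -> S -> R).
Hypothesis sW : separable W.
Hypothesis f0 : forall v x, 0 <= f v x.
Hypothesis mf : forall (O : set W) (t : R), open O ->
  measurable ([set x | exists v, [/\ O v, C v & f v x < t]] : set (completed mu)).
Hypothesis lscf : forall x v t, C v -> t < f v x ->
  \forall v' \near v, C v' -> t < f v' x.

(** Including [M] in the set truncates the infimum at [M], and gives the value [M]
    when [O] misses [C]. *)
Let h (O : set W) (M : nat) (x : S) : R :=
  inf ([set M%:R] `|` [set f v x | v in O `&` C]).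

Let h_has_inf O M x : has_inf ([set M%:R] `|` [set f v x | v in O `&` C]).
Proof.
split; first by exists M%:R; left.
by exists 0 => _ [->|[v _ <-]].
Qed.

Let h_bnd O M x : 0 <= h O M x <= M%:R.
Proof.
have [h1 h2] := h_has_inf O M x.
apply/andP; split; first by apply: lb_le_inf => // _ [->|[v _ <-]].
by apply: ge_inf => //; left.
Qed.

Let h_le O M x v : O v -> C v -> h O M x <= f v x.
Proof.
have [h1 h2] := h_has_inf O M x.
by move=> Ov Cv; apply: ge_inf => //; right; exists v.
Qed.

Let h_measurable O M : open O ->
  measurable_fun setT (h O M : completed mu -> R).
Proof.
move=> oO _; apply: (measurability _ (RGenInftyO.measurableE R)) => //.
move=> _ [_ [t ->] <-]; rewrite setTI.
have -> : h O M @^-1` `]-oo, t[ = [set x | M%:R < t] `|`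
    [set x | exists v, [/\ O v, C v & f v x < t]].
  apply/seteqP; split => x /=; rewrite in_itv/=.
    move=> /(inf_lt (proj1 (h_has_inf O M x))) [_ [->|[v [Ov Cv] <-]]] ft; first by left.
    by right; exists v.
  case=> [Mt|[v [Ov Cv ft]]].
    by apply: le_lt_trans Mt; case/andP: (h_bnd O M x).
  by apply: le_lt_trans ft; exact: h_le.
apply: measurableU; last exact: mf.
by have [Mt|Mt] := pselect (M%:R < t);
  [rewrite (_ : [set _ | _] = setT)//; apply/seteqP; split
  |rewrite (_ : [set _ | _] = set0)//; apply/seteqP; split].
Qed.

(** The points [v] may be uncountably many, but every [v] lies in balls of arbitrarily
    small radius around points of a dense sequence, and the strong law holds almost
    surely for the truncated infima [h] over all these balls at once. As the balls
    shrink to [v] and the truncation level grows, these infima converge to [f v];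
    by the lemma of Fatou one of them has expectation above [c], and on its ball
    the sample means dominate those of the infimum. *)
Lemma epi_lln_lower : {ae P, forall w, forall v (c : R), C v ->
  (c%:E < \int[P]_w (f v (xi w))%:E)%E ->
  exists2 O, nbhs v O & \forall N \near \oo, forall v', O v' -> C v' ->
    c * N%:R < \sum_(i < N) f v' (xis i w)}.
Proof.
have [q qdense] := separable_sequence sW.
pose Bj j k := ball (q j) (k.+1%:R^-1 : R).
have H j k M : {ae P, forall w, forall c : R,
    (c%:E < \int[P]_w (h (Bj j k) M (xi w))%:E)%E ->
    \forall N \near \oo, c * N%:R < \sum_(i < N) h (Bj j k) M (xis i w)}.
  have mh : measurable_fun setT (h (Bj j k) M : completed mu -> R).
    by apply: h_measurable; exact: ball_open.
  have iidh := pairwise_iid_completed cP lxis ixis mh.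
  have := @lln_bounded_lower_all _ M%:R iidh (fun k w => h_bnd _ M _).
  by rewrite (integral_comp_completed cP lxis)// => x; case/andP: (h_bnd (Bj j k) M x).
have {}H := ae_foralln (fun j => ae_foralln (fun k => ae_foralln (H j k))).
move: H; apply: filterS => w H v c Cv cf.
have jn n : exists j, ball v (n.+1%:R^-1 : R) (q j) by apply: qdense; rewrite invr_gt0.
pose j n := sval (cid (jn n)).
have vj n : Bj (j n) n v by apply: ball_sym; exact: (svalP (cid (jn n))).
pose g n x := (h (Bj (j n) n) n x)%:E.
have mg n : measurable_fun setT (fun w => g n (xi w)).
  apply/measurable_EFinP; apply: (measurable_comp_completed cP (xi := xi)) => //.
  by apply: h_measurable; exact: ball_open.
have g0 n x : (0 <= g n x)%E by rewrite lee_fin; case/andP: (h_bnd (Bj (j n) n) n x).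
have fg x : ((f v x)%:E = limn_einf (g^~ x))%E.
  apply/eqP; rewrite eq_le; apply/andP; split; last first.
    rewrite limn_einf_lim (cvg_lim _ (@cvg_einfs_sup _ _))//.
    apply: ub_ereal_sup => _ [n _ <-]; apply: (@le_trans _ _ (g n x)).
      by apply: ereal_inf_lbound; exists n => //=.
    by rewrite lee_fin h_le.
  apply/lee_addgt0Pr => e e0.
  have te : f v x - e < f v x by rewrite gtrBl.
  have /nbhs_ballP[r /= r0 Hr] := lscf Cv te.
  have r20 : 0 < r / 2 by rewrite divr_gt0.
  have [K _ HK] := near_infty_natSinv_lt (PosNum r20).
  rewrite -leeBlDr// -EFinB.
  pose K' := maxn K (Num.truncn (f v x - e)).+1.
  apply: (@le_trans _ _ (einfs (g^~ x) K')); last first.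
    rewrite limn_einf_lim (cvg_lim _ (@cvg_einfs_sup _ _))//.
    by apply: ereal_sup_ubound; exists K'.
  apply: le_ereal_inf_tmp => _ [n /= Kn <-]; rewrite lee_fin.
  have [h1 h2] := h_has_inf (Bj (j n) n) n x.
  apply: lb_le_inf => // _ [->|[v' [Bv' Cv'] <-]].
    rewrite (le_trans (ltW (truncnS_gt _)))// ler_nat.
    by rewrite (leq_trans _ Kn)// leq_maxr.
  apply/ltW/Hr => //; apply: le_ball (ball_triangle (ball_sym (vj n)) Bv').
  have nr : n.+1%:R^-1 < r / 2 := HK n (leq_trans (leq_maxl _ _) Kn).
  by rewrite [leRHS]splitr lerD// ltW.
have [n cn] : exists n, (c%:E < \int[P]_w g n (xi w))%E.
  apply: contrapT => /forallNP nc.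
  have : (\int[P]_w (f v (xi w))%:E <= c%:E)%E.
    under eq_integral do rewrite fg.
    apply: (le_trans (fatou P measurableT mg _)) => //.
    rewrite limn_einf_lim (cvg_lim _ (@cvg_einfs_sup _ _))//.
    apply: ub_ereal_sup => _ [n _ <-].
    apply: (@le_trans _ _ (\int[P]_w g n (xi w))%E).
      by apply: ereal_inf_lbound; exists n => //=.
    by rewrite leNgt; apply/negP/nc.
  by rewrite leNgt cf.
exists (Bj (j n) n).
  by apply: open_nbhs_nbhs; split => //; exact: ball_open.
move: (H (j n) n n c cn); apply: filterS => N /lt_le_trans HN v' Ov' Cv'.
by apply: HN; apply: ler_sum => i _; exact: h_le.
Qed.

End epi_liminf.

(** * Measurability of lower semicontinuous integrands *)

Section lsc_integrands.
Context d (S : measurableType d) (R : realType) (W : normedModType R).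
Implicit Types f : W -> S -> R.

(** The sets are the events that the infimum of [f] over [O `&` C] is below [t]. *)
Definition open_infima_measurable (C : set W) f := forall (O : set W) (t : R), open O ->
  measurable [set x | exists v, [/\ O v, C v & f v x < t]].

Definition lsc_on (C : set W) f := forall x v t, C v -> t < f v x ->
  \forall v' \near v, C v' -> t < f v' x.

(** By lower semicontinuity, [f v x] is the limit of the infima of [f ^~ x] over
    balls shrinking to [v]. *)
Lemma measurable_section C f v : open_infima_measurable C f -> lsc_on C f ->
  C v -> measurable_fun setT (f v).
Proof.
move=> mf lf Cv _; apply: (measurability _ (RGenOInfty.measurableE R)) => //.
move=> _ [_ [t ->] <-]; rewrite setTI.
have -> : f v @^-1` `]t, +oo[ = ~` \bigcap_n [set x | exists v',
    [/\ ball v (n.+1%:R^-1 : R) v', C v' & f v' x < t + n.+1%:R^-1]].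
  rewrite eqEsubset; split => x /=; rewrite in_itv/= andbT.
    move=> tf H; pose t' := (t + f v x) / 2.
    have tt' : 0 < t' - t by rewrite /t'; lra.
    have t'f : t' < f v x by rewrite /t'; lra.
    have /nbhs_ballP[r /= r0 Hr] := lf x v t' Cv t'f.
    have [K1 _ HK1] := near_infty_natSinv_lt (PosNum r0).
    have [K2 _ HK2] := near_infty_natSinv_lt (PosNum tt').
    pose n := maxn K1 K2.
    have n1 : n.+1%:R^-1 < r := HK1 n (leq_maxl _ _).
    have n2 : n.+1%:R^-1 < t' - t := HK2 n (leq_maxr _ _).
    have [v' [vv' Cv' ft]] := H n I.
    have := Hr _ (le_ball (ltW n1) vv') Cv'.
    by move: n2 ft; set z : R := _^-1; set y := f v' x; lra.
  rewrite ltNge; apply: contra_notN => ft n _; exists v; split => //.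
    by apply: ballxx; rewrite invr_gt0.
  by rewrite (le_lt_trans ft)// ltrDl invr_gt0.
apply: measurableC; apply: bigcap_measurable => // n _.
by apply: mf; exact: ball_open.
Qed.

(** The event is that the epigraph meets the open set [O `*` [set r | r < t]]. *)
Lemma random_lsc_open_infima f : random_lsc S f -> open_infima_measurable setT f.
Proof.
move=> [_ mf] O t oO.
have oOt : open (O `*` [set r : R^o | r < t]).
  apply: openI.
  - by apply: open_comp => // z _; exact: cvg_fst.
  - by apply: (@open_comp _ _ snd _ _ (@open_lt _ t)) => z _; exact: cvg_snd.
rewrite (_ : [set x | _] =
  [set s | [set wt : W * R^o | f wt.1 s <= wt.2] `&` (O `*` [set r : R^o | r < t]) !=set0]).
  exact: mf.
apply/seteqP; split => x /=.
  by move=> [v [Ov _ ft]]; exists (v, f v x); split => //=; exact: lexx.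
by move=> [[v r] /= [fr [Ov rt]]]; exists v; split => //; exact: le_lt_trans rt.
Qed.

Lemma random_lsc_lsc f : random_lsc S f -> lsc_on setT f.
Proof.
move=> [cf _] x v t _ tf.
have := closed_openC (cf x); rewrite openE => /(_ (v, t : R^o)) /=.
rewrite leNgt tf => /(_ notF); rewrite /interior => nvt.
case: nvt => -[A B] [/= nA nB] AB; move: nA; apply: filterS => v' Av' _.
have := AB (v', t : R^o) (conj Av' (nbhs_singleton nB)) => /=.
by rewrite ltNge => /negP.
Qed.

Context (Y : completeNormedModType R) (beta : Y -> R).

Lemma caratheodory_comp_cvg C (G : W -> S -> Y) x v : continuous beta ->
  caratheodory_on S C G -> C v ->
  beta (G v' x) @[v' --> within C (nbhs v)] --> beta (G v x).
Proof.
move=> cb [cG _] Cv.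
have /subspace_continuousP/(_ v Cv) := cG x.
by move=> /cvg_comp; apply; exact: cb.
Qed.

Lemma caratheodory_lsc C (G : W -> S -> Y) : continuous beta ->
  caratheodory_on S C G -> lsc_on C (fun v x => beta (G v x)).
Proof.
move=> cb cG x v t Cv tb.
have := caratheodory_comp_cvg (x := x) cb cG Cv.
by move=> /cvgr_gt/(_ t tb).
Qed.

(** By continuity on [C], the infimum over [O `&` C] is an infimum over a countable
    dense subset of [C], whose points [p j k] are chosen in the traces on [C] of the
    balls of a countable base of [W]. *)
Lemma caratheodory_open_infima C (G : W -> S -> Y) : separable W -> continuous beta ->
  caratheodory_on S C G -> open_infima_measurable C (fun v x => beta (G v x)).
Proof.
move=> sW cb cG O t oO; have [_ mG] := cG.
have [q qdense] := separable_sequence sW.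
(* The default value 0 for an empty trace is harmless, since membership in [O] and
   [C] is required again below. *)
pose p j k := xget 0 (ball (q j) (k.+1%:R^-1 : R) `&` C).
rewrite (_ : [set x | _] = \bigcup_j \bigcup_k
   [set x | [/\ O (p j k), C (p j k) & beta (G (p j k) x) < t]]).
  apply: bigcup_measurable => j _; apply: bigcup_measurable => k _.
  have [[Op Cp]|nOC] := pselect (O (p j k) /\ C (p j k)).
    rewrite (_ : [set x | _] = G (p j k) @^-1` (beta @^-1` [set r | r < t])).
      rewrite -[_ @^-1` _]setTI; apply: (mG _ Cp) => //.
      by apply: sub_sigma_algebra; apply: open_comp; [move=> y _; exact: cb|exact: open_lt].
    by apply/seteqP; split => x /= => [[]//|]; split.
  rewrite (_ : [set x | _] = set0)//; apply/seteqP; split => x //= [Op Cp _].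
  by apply: nOC.
apply/seteqP; split => x /=; last first.
  by move=> [j _ [k _ [Op Cp pt]]]; exists (p j k).
move=> [v [Ov Cv bt]].
have near_t : \forall v' \near v, C v' -> beta (G v' x) < t.
  by have /cvgr_lt/(_ t bt) := caratheodory_comp_cvg (x := x) cb cG Cv.
have near_O : \forall v' \near v, O v' by exact: open_nbhs_nbhs.
have nbv : nbhs v ([set v' | C v' -> beta (G v' x) < t] `&` O) by exact: filterI.
have /nbhs_ballP[r /= r0 Hr] := nbv.
have r20 : 0 < r / 2 by rewrite divr_gt0.
have [k _ /(_ k (leqnn k))/= kr] := near_infty_natSinv_lt (PosNum r20).
have [j vqj] : exists j, ball v (k.+1%:R^-1 : R) (q j).
  by apply: qdense; rewrite invr_gt0.
have [qp Cp] : (ball (q j) (k.+1%:R^-1 : R) `&` C) (p j k).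
  rewrite /p; case: xgetP => [y -> //|/(_ v)] []; split => //.
  exact: ball_sym.
have vp : ball v r (p j k).
  apply: le_ball (ball_triangle vqj qp).
  by rewrite [leRHS]splitr lerD// ltW.
have [pt Op] := Hr _ vp.
by exists j => //; exists k => //; split => //; exact: pt.
Qed.

End lsc_integrands.

(** * Weak* limit points in the dual of a separable space *)

Lemma filter_forall_in (T : eqType) X (F : set_system X) (A : T -> set X) (s : seq T) :
  Filter F -> (forall i, F (A i)) -> F [set x | forall i, i \in s -> A i x].
Proof.
move=> FF FA; elim: s => [|j s ih]; first by apply: filterS filterT => x _ i.
apply: filterS (filterI (FA j) ih) => x [Aj As] i; rewrite inE => /orP[/eqP->//|].
exact: As.
Qed.

Section weakstar.
Context (R : realType) (V : normedModType R).
Implicit Types (f g : dual V) (u : nat -> dual V).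

Lemma dual_linear f : linear (f : V -> R^o).
Proof. by case: f => f /= /asboolP[]. Qed.

Lemma dual_continuous f : continuous (f : V -> R^o).
Proof. by case: f => f /= /asboolP[]. Qed.

Lemma dualZ f a v : f (a *: v) = a * f v.
Proof.
have f0 : f 0 = 0.
  by have := dual_linear f (-1) 0 0; rewrite scaler0 add0r scaleN1r addNr.
by have := dual_linear f a v 0; rewrite f0 !addr0.
Qed.

Lemma dualB f v w : f (v - w) = f v - f w.
Proof.
by have := dual_linear f (-1) w v; rewrite !scaleN1r [in LHS]addrC => ->; rewrite addrC.
Qed.

Lemma dual_norm_has_sup f :
  has_sup [set `|f v| | v in [set v : V | `|v| <= 1]].
Proof.
pose fl : {linear V -> R^o} := HB.pack (f : V -> R^o)
  (GRing.isLinear.Build _ _ _ _ _ (dual_linear f)).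
have cf : {for 0, continuous fl} := @dual_continuous f 0.
have /linear_boundedP/pinfty_ex_gt0[M _ HM] := continuous_linear_bounded 0 cf.
split; first by exists `|f 0|; exists 0 => //=; rewrite normr0.
exists `|M| => _ [x /= x1 <-]; apply: (le_trans (HM x)).
by apply: (le_trans (ler_norm _)); rewrite normrM normr_id ler_piMr.
Qed.

Lemma dual_norm_ge0 f : 0 <= dual_norm f.
Proof.
apply: (le_trans (normr_ge0 (f 0))); apply: sup_ubound.
  exact: (proj2 (dual_norm_has_sup f)).
by exists 0 => //=; rewrite normr0.
Qed.

Lemma le_dual_norm f v : `|f v| <= dual_norm f * `|v|.
Proof.
have [->|v0] := eqVneq v 0.
  by rewrite normr0 mulr0 -(scale0r 0) dualZ mul0r normr0.
rewrite -ler_pdivrMr ?normr_gt0// -[X in _ / X]normr_id -normf_div mulrC -dualZ.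
apply: sup_ubound; first exact: (proj2 (dual_norm_has_sup f)).
exists (`|v|^-1 *: v) => //=.
by rewrite normrZ normfV normr_id mulVf// normr_eq0.
Qed.

Lemma weakstar_cvgP u f :
  weakstar_cvg u f <-> forall v, (u n v : R^o) @[n --> \oo] --> (f v : R^o).
Proof.
have ptwsP := @pointwise_cvgP V R^o ((u : nat -> {ptws V -> R^o}) @ \oo) f _.
split=> [uf|/ptwsP uf].
  apply/ptwsP => A fA; exact: (uf ((fun f : dual V => (f : {ptws V -> R^o})) @^-1` A)
    (@initial_continuous _ _ (fun f : dual V => (f : {ptws V -> R^o})) f A fA)).
move=> A [_ [[B oB <-] Bf BA]].
have : nbhs (f : {ptws V -> R^o}) B by exact: open_nbhs_nbhs.
by case/uf => N _ HN; exists N => // n /HN; exact: BA.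
Qed.

Lemma weakstar_nbhs f v (e : R) : 0 < e ->
  nbhs (f : weakstar V) [set g : weakstar V | `|f v - (g : dual V) v| < e].
Proof.
move=> e0; apply: (@initial_continuous _ _ (fun f : dual V => (f : {ptws V -> R^o})) f
  [set g : {ptws V -> R^o} | `|f v - g v| < e]).
have := @proj_continuous V (fun=> R^o) v (f : {ptws V -> R^o}).
by move=> /(_ (ball (f v : R^o) e)); apply; exact: nbhsx_ballx.
Qed.

(** On norm-bounded sets the weak* topology is determined by the values on a dense
    sequence [q], so it suffices to choose [phi k] with [u (phi k)] within
    [1 / (k + 1)] of [f] at the first [k] points of [q]. The norm bound extends the
    convergence to all of [V]. *)
Lemma cluster_weakstar_subsequence u f (M : R) : separable V ->
    (forall n, (0 < n)%N -> dual_norm (u n) <= M) -> weakstar_limit_point u f ->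
  exists2 phi : nat -> nat, (forall k, (k < phi k)%N) & weakstar_cvg (u \o phi) f.
Proof.
move=> sV uM fu; have [q qdense] := separable_sequence sV.
have H k : exists n, (k < n)%N /\ forall j, (j < k)%N -> `|f (q j) - u n (q j)| < k.+1%:R^-1.
  pose A := [set g : weakstar V | exists2 n, (k < n)%N & g = u n].
  pose B := [set g : weakstar V | forall j, j \in iota 0 k ->
    `|f (q j) - (g : dual V) (q j)| < k.+1%:R^-1].
  have [] := fu A B.
  - by exists k.+1 => // n /= kn; exists n.
  - apply: filter_forall_in => j.
    by apply: weakstar_nbhs; rewrite invr_gt0.
  - by move=> g [[n kn ->] Bg]; exists n; split => // j jk; apply: Bg; rewrite mem_iota.
pose phi k := sval (cid (H k)).
have phik k : (k < phi k)%N by case: (svalP (cid (H k))).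
have phiq k j : (j < k)%N -> `|f (q j) - u (phi k) (q j)| < k.+1%:R^-1.
  by case: (svalP (cid (H k))) => _; exact.
exists phi => //; apply/weakstar_cvgP => v.
apply/cvgrPdist_lt => e e0.
pose L := `|M| + dual_norm f + 1.
have L0 : 0 < L.
  by rewrite ltr_wpDl// addr_ge0// dual_norm_ge0.
have [j vj] : exists j, ball v (e / 3 / L) (q j) by apply: qdense; rewrite !divr_gt0.
have e30 : 0 < e / 3 by rewrite divr_gt0.
have [K _ HK] := near_infty_natSinv_lt (PosNum e30).
exists (maxn K j.+1) => // k /= kK.
have k1 : k.+1%:R^-1 < e / 3 := HK k (leq_trans (leq_maxl _ _) kK).
have mulLe a (b : R) : a <= L -> b < e / 3 / L -> 0 <= b -> a * b <= e / 3.
  move=> aL bL b0; apply: (@le_trans _ _ (L * b)); first by rewrite ler_wpM2r.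
  by rewrite mulrC -ler_pdivlMr// ltW.
have k2 := lt_trans (phiq k j (leq_trans (leq_maxr _ _) kK)) k1.
have vq : `|v - q j| < e / 3 / L by move: vj; rewrite -ball_normE.
have f1 : `|f v - f (q j)| <= e / 3.
  rewrite -dualB (le_trans (le_dual_norm _ _))//.
  by apply: mulLe vq _ => //; rewrite /L; have := normr_ge0 M; have := dual_norm_ge0 f; lra.
have f2 : `|u (phi k) (q j) - u (phi k) v| <= e / 3.
  rewrite -dualB (le_trans (le_dual_norm _ _))// distrC.
  apply: mulLe vq _ => //; rewrite /L.
  have := uM (phi k) (leq_ltn_trans (leq0n k) (phik k)).
  by have := ler_norm M; have := dual_norm_ge0 f; lra.
rewrite (_ : f v - _ = (f v - f (q j)) + (f (q j) - u (phi k) (q j)) +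
   (u (phi k) (q j) - u (phi k) v)); last by ring.
rewrite (le_lt_trans (ler_normD _ _))//.
have : `|f v - f (q j) + (f (q j) - u (phi k) (q j))| < e / 3 + e / 3.
  by rewrite (le_lt_trans (ler_normD _ _))// ler_ltD.
move: f2; set x := `|_|; set y := `|_|; lra.
Qed.

(** The theorem of Banach and Alaoglu: by the theorem of Tychonoff the functions
    bounded by [M * `|v|] at every [v] form a compact set for pointwise convergence,
    and a pointwise limit point [g] of linear functions is linear. *)
Lemma bounded_weakstar_limit_point u (M : R) : (forall n, dual_norm (u n) <= M) ->
  exists f, weakstar_limit_point u f.
Proof.
move=> uM.
pose A : set {ptws V -> R^o} := [set g | forall v, `[- (M * `|v|), M * `|v|]%classic (g v)].
have cA : compact A.
  exact: (@tychonoff V (fun=> R^o) (fun v => `[- (M * `|v|), M * `|v|]%classic)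
    (fun v => @segment_compact R _ _)).
pose F : set_system {ptws V -> R^o} := (u : nat -> {ptws V -> R^o}) @ \oo.
have FA : F A.
  exists 0%N => // n _ v /=; rewrite in_itv/= -ler_norml.
  by rewrite (le_trans (le_dual_norm _ _))// ler_wpM2r.
have [g [Ag gF]] := cA F _ FA.
have near_g (s : seq V) (e : R) : 0 < e ->
    exists n, forall v, v \in s -> `|g v - u n v| < e.
  move=> e0.
  pose B := [set h : {ptws V -> R^o} | forall v, v \in s -> `|g v - h v| < e].
  have [] := gF [set h : {ptws V -> R^o} | exists n, h = (u n : V -> R^o)] B.
  - by exists 0%N => // n _; exists n.
  - apply: filter_forall_in => v.
    have := @proj_continuous V (fun=> R^o) v g.
    by move=> /(_ (ball (g v : R^o) e)); apply; exact: nbhsx_ballx.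
  - by move=> h [[n ->] Bn]; exists n.
have lg : linear (g : V -> R^o).
  move=> a v w; apply/eqP; rewrite -subr_eq0 -normr_le0.
  apply/ler_addgt0Pr => e e0; rewrite add0r.
  have a0 : 0 < 2 + `|a| by rewrite ltr_pwDl.
  have [n gn] := near_g [:: a *: v + w; v; w] (e / (2 + `|a|)) (divr_gt0 e0 a0).
  have [] := (gn (a *: v + w), gn v, gn w); rewrite !inE !eqxx !orbT => -[].
  move=> /(_ isT) g1 /(_ isT) g2 /(_ isT) g3.
  have un : u n (a *: v + w) = a * u n v + u n w by exact: dual_linear.
  rewrite (_ : g _ - _ = (g (a *: v + w) - u n (a *: v + w)) - a * (g v - u n v)
     - (g w - u n w)); last first.
    by rewrite un /GRing.scale/=; ring.
  rewrite (le_trans (ler_normB _ _))//.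
  rewrite (le_trans (lerD (ler_normB _ _) (lexx _)))// normrM.
  have -> : e = e / (2 + `|a|) + `|a| * (e / (2 + `|a|)) + e / (2 + `|a|).
    by field; rewrite gt_eqF.
  by rewrite !lerD// ?ler_wpM2l// ltW.
have gM v : `|g v| <= M * `|v| by rewrite ler_norml; have := Ag v; rewrite /= in_itv.
have cg : continuous (g : V -> R^o).
  pose gl : {linear V -> R^o} := HB.pack g (GRing.isLinear.Build _ _ _ _ _ lg).
  apply: (@bounded_linear_continuous _ _ _ gl); apply/linear_boundedP.
  apply: filterS (nbhs_pinfty_ge (num_real M)) => r Mr v.
  by apply: (le_trans (gM v)); rewrite ler_wpM2r.
have gin : (g : V -> R^o) \in @lincont R V by apply/asboolP; split.
exists (Dual gin) => B C FB [_ [[D oD <-] Df DC]].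
have [] := gF ((fun f : dual V => (f : {ptws V -> R^o})) @` B) D.
- by case: FB => N _ HN; exists N => // n /HN Bn; exists (u n).
- exact: open_nbhs_nbhs.
- by move=> _ [[f Bf <-] Df']; exists f; split => //; exact: DC.
Qed.

End weakstar.

(** * Convergence of penalized problems *)

Section penalized_limit.
Context (R : realType) (V : normedModType R).
Local Open Scope ereal_scope.

Lemma limn_einf_gt (x : nat -> \bar R) (t l : \bar R) :
  l <= limn_einf x -> t < l -> \forall n \near \oo, t < x n.
Proof.
move=> lx tl; have := lt_le_trans tl lx.
rewrite limn_einf_lim (cvg_lim _ (@cvg_einfs_sup _ _))//.
move=> /ereal_sup_gt[_ [n _ <-]] tn; exists n => // k /= nk.
by apply: (lt_le_trans tn); apply: ereal_inf_lbound; exists k.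
Qed.

(** The deterministic core: [a N] and [b N] stand for the sample means of the cost
    and of the penalty on a fixed sample, [F] and [H] for their expectations. *)
Variables (psi F H : dual V -> \bar R) (a b : nat -> dual V -> R).
Variables (gamma : nat -> R) (feas : set (dual V)) (u : nat -> dual V).
Let D := effective_domain psi.
Let saa N v := (a N v)%:E + psi v + (gamma N * b N v)%:E.
Let objective v := F v + psi v.
Hypothesis sV : separable V.
Hypothesis psi0 : forall v, 0 <= psi v.
Hypothesis psi_lsc : seq_weakstar_lsc psi.
Hypothesis D_bounded : dual_bounded D.
Hypothesis D_closed : seq_weakstar_closed D.
Hypothesis F0 : forall v, 0 <= F v.
Hypothesis Foo : forall v, F v < +oo.
Hypothesis H0 : forall v, 0 <= H v.
Hypothesis feas_ex : exists2 v, feas v & objective v < +oo.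
Hypothesis a0 : forall N v, (0 <= a N v)%R.
Hypothesis b0 : forall N v, (0 <= b N v)%R.
Hypothesis gamma0 : forall N, (0 < N)%N -> (0 < gamma N)%R.
Hypothesis gammaoo : gamma @ \oo --> +oo%R.
Hypothesis a_liminf : forall (v_ : nat -> dual V) (phi : nat -> nat) v (c : R),
  (forall k, (k < phi k)%N) -> (forall k, D (v_ k)) -> D v -> weakstar_cvg v_ v ->
  c%:E < F v -> \forall k \near \oo, (c < a (phi k) (v_ k))%R.
Hypothesis b_liminf : forall (v_ : nat -> dual V) (phi : nat -> nat) v (c : R),
  (forall k, (k < phi k)%N) -> (forall k, D (v_ k)) -> D v -> weakstar_cvg v_ v ->
  c%:E < H v -> \forall k \near \oo, (c < b (phi k) (v_ k))%R.
Hypothesis H_feas : forall v, D v -> H v = 0 -> feas v.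
Hypothesis saa_limsup : forall c : R, optimal_value feas objective < c%:E ->
  \forall N \near \oo, optimal_value setT (saa N) <= c%:E.
Hypothesis u_sol : forall N, (0 < N)%N -> is_solution setT (saa N) (u N).

Let saa_ge N v : (0 < N)%N -> psi v <= saa N v.
Proof.
move=> N0; apply: (@le_trans _ _ ((a N v)%:E + psi v)).
  by rewrite leeDr// lee_fin.
by rewrite leeDl// lee_fin mulr_ge0// ltW// gamma0.
Qed.

Let D_u N : (0 < N)%N -> D (u N).
Proof.
move=> N0; have [v _ vo] := feas_ex.
have [_ /(_ v I) uv] := u_sol N0.
apply: (le_lt_trans (saa_ge (u N) N0)); apply: (le_lt_trans uv).
have vD : psi v < +oo.
  by apply: le_lt_trans vo; rewrite /objective leeDr.
by rewrite /saa lte_add_pinfty ?ltry// lte_add_pinfty ?ltry.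
Qed.

Let saaE N : (0 < N)%N -> optimal_value setT (saa N) = saa N (u N).
Proof.
move=> N0; have [_ uv] := u_sol N0.
apply/eqP; rewrite eq_le; apply/andP; split.
  by apply: ereal_inf_lbound; exists (u N).
by apply: le_ereal_inf_tmp => _ [v _ <-]; exact: uv.
Qed.

(** If the limit had expected penalty above [e > 0], the penalty terms would
    eventually exceed [c]. The bound on the objective is lower semicontinuity of
    the cost and of [psi] along the subsequence. *)
Lemma subsequence_limit_feasible (phi : nat -> nat) ubar (c : R) :
    (forall k, (k < phi k)%N) -> weakstar_cvg (u \o phi) ubar ->
    (\forall k \near \oo, saa (phi k) (u (phi k)) <= c%:E) ->
  feas ubar /\ objective ubar <= c%:E.
Proof.
move=> kphi uphi saac.
have phi0 k : (0 < phi k)%N by exact: leq_ltn_trans (kphi k).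
have Dphi k : D ((u \o phi) k) by exact: D_u.
have Dubar : D ubar by apply: D_closed uphi.
split.
  apply: H_feas => //; apply/eqP; rewrite eq_le H0 andbT leNgt; apply/negP => Hpos.
  have [e e0 eH] : exists2 e : R, (0 < e)%R & e%:E < H ubar.
    case: (H ubar) (H0 ubar) Hpos => [r| |]//.
      rewrite lte_fin => _ r0; exists (r / 2)%R; first by rewrite divr_gt0.
      by rewrite lte_fin; lra.
    by move=> _ _; exists 1%R => //; exact: ltry.
  have near_b := b_liminf kphi Dphi Dubar uphi eH.
  have near_gamma : \forall k \near \oo, (c / e < gamma (phi k))%R.
    have /cvgryPgt/(_ (c / e)%R)[K _ HK] := gammaoo.
    by exists K => // k /= Kk; apply: HK => /=; rewrite (leq_trans Kk)// ltnW.
  have [k [[bk gk] ck]] := filter_ex (filterI (filterI near_b near_gamma) saac).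
  move: ck; apply/negP; rewrite -ltNge.
  apply: (@lt_le_trans _ _ (gamma (phi k) * b (phi k) (u (phi k)))%:E).
    rewrite lte_fin; move: gk bk; rewrite ltr_pdivrMr// => gk bk.
    by apply: (lt_trans gk); rewrite ltr_pM2l// gamma0.
  by rewrite /saa leeDr// adde_ge0// lee_fin.
have Ffin : F ubar \is a fin_num by rewrite ge0_fin_numE.
have Pfin : psi ubar \is a fin_num by rewrite ge0_fin_numE.
rewrite leNgt; apply/negP => cobj.
pose e := ((fine (F ubar) + fine (psi ubar) - c) / 2)%R.
have e0 : (0 < e)%R.
  move: cobj; rewrite /objective -(fineK Ffin) -(fineK Pfin) -EFinD lte_fin /e /=.
  by move=> cobj; rewrite divr_gt0// subr_gt0.
have cE : (c = (fine (F ubar) - e) + (fine (psi ubar) - e))%R by rewrite /e; field.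
have aF : (fine (F ubar) - e)%:E < F ubar.
  by rewrite -{2}(fineK Ffin) lte_fin gtrBl.
have bP : (fine (psi ubar) - e)%:E < psi ubar.
  by rewrite -{2}(fineK Pfin) lte_fin gtrBl.
have near_a := a_liminf kphi Dphi Dubar uphi aF.
have near_psi := limn_einf_gt (psi_lsc uphi) bP.
have [k [[ak pk] ck]] := filter_ex (filterI (filterI near_a near_psi) saac).
move: ck; apply/negP; rewrite -ltNge /saa cE EFinD.
apply: (@lt_le_trans _ _ ((a (phi k) (u (phi k)))%:E + psi (u (phi k)))).
  by apply: lteD => //; rewrite lte_fin.
by rewrite leeDl// lee_fin mulr_ge0// ltW// gamma0.
Qed.

(** Given [saa_limsup], a failure of convergence means that values below
    [optimal_value feas objective - e] occur infinitely often. By compactness the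
    corresponding minimizers have a weak* convergent subsequence, whose limit would
    be feasible with an objective below the optimal value. *)
Lemma penalized_limit :
  ((fun N => optimal_value setT (saa N)) @ \oo --> optimal_value feas objective) /\
  forall ubar, weakstar_limit_point u ubar -> is_solution feas objective ubar.
Proof.
have [M uM] : exists M, forall N, (0 < N)%N -> (dual_norm (u N) <= M)%R.
  by have [M HM] := D_bounded; exists M => N N0; apply: HM; exact: D_u.
set r := optimal_value feas objective.
have r0 : 0 <= r by apply: le_ereal_inf_tmp => _ [v _ <-]; exact: adde_ge0.
have rfin : r \is a fin_num.
  rewrite ge0_fin_numE//; have [v fv vo] := feas_ex; apply: le_lt_trans vo.
  by apply: ereal_inf_lbound; exists v.
have saa0 N : (0 < N)%N -> 0 <= optimal_value setT (saa N).
  by move=> N0; rewrite saaE//; exact: le_trans (saa_ge _ N0).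
split; last first.
  move=> ubar uubar.
  have [phi kphi uphi] := cluster_weakstar_subsequence sV uM uubar.
  have key (c : R) : r < c%:E -> feas ubar /\ objective ubar <= c%:E.
    move=> rc; apply: (subsequence_limit_feasible kphi uphi).
    have [K _ HK] := saa_limsup rc; exists K => // k /= Kk.
    by rewrite -saaE ?(leq_ltn_trans _ (kphi k))//; apply: HK => /=;
      rewrite (leq_trans Kk)// ltnW.
  have r1 (e : R) : (0 < e)%R -> r < (fine r + e)%:E.
    by move=> e0; rewrite -{1}(fineK rfin) lte_fin ltrDl.
  split; first by have [] := key _ (r1 1%R ltr01).
  move=> v fv; apply: (@le_trans _ _ r); last by apply: ereal_inf_lbound; exists v.
  rewrite -(fineK rfin); apply/lee_addgt0Pr => e e0.
  by rewrite -EFinD; have [] := key _ (r1 e e0).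
rewrite -(fineK rfin); apply/fine_cvgP.
have upper (e : R) : (0 < e)%R -> \forall N \near \oo,
    optimal_value setT (saa N) <= (fine r + e)%:E.
  by move=> e0; apply: saa_limsup; rewrite -/r -{1}(fineK rfin) lte_fin ltrDl.
have fin : \forall N \near \oo, optimal_value setT (saa N) \is a fin_num.
  have [K _ HK] := upper 1%R ltr01; exists K.+1 => // N /= KN.
  rewrite ge0_fin_numE ?saa0 ?(leq_ltn_trans _ KN)//.
  by apply: (le_lt_trans (HK N (ltnW KN))); exact: ltry.
split => //; apply/cvgrPdist_le => e e0.
have lower : \forall N \near \oo, (fine r - e)%:E <= optimal_value setT (saa N).
  apply: contrapT => nlow.
  have low n : exists N, (n < N)%N /\ optimal_value setT (saa N) < (fine r - e)%:E.
    apply: contrapT => /forallNP nN; apply: nlow; exists n.+1 => // N /= nN'.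
    by rewrite leNgt; apply/negP => lt; apply: (nN N); split.
  pose idx n := sval (cid (low n)).
  have idx_gt n : (n < idx n)%N by case: (svalP (cid (low n))).
  have idx_lt n : optimal_value setT (saa (idx n)) < (fine r - e)%:E.
    by case: (svalP (cid (low n))).
  have upM n : (dual_norm ((u \o idx) n) <= M)%R.
    by apply: uM; exact: leq_ltn_trans (idx_gt n).
  have [ubar uubar] := bounded_weakstar_limit_point upM.
  have [phi kphi uphi] := cluster_weakstar_subsequence sV (fun n _ => upM n) uubar.
  have kpp k : (k < (idx \o phi) k)%N by exact: ltn_trans (idx_gt _).
  have [|fubar oubar] := @subsequence_limit_feasible (idx \o phi) ubar (fine r - e) kpp uphi.
    exists 0%N => // k _ /=.
    by rewrite -saaE ?(leq_ltn_trans _ (idx_gt _))// ltW.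
  have : r <= objective ubar by apply: ereal_inf_lbound; exists ubar.
  move=> /le_trans/(_ oubar); rewrite [leLHS](_ : r = (fine r)%:E); last by rewrite fineK.
  rewrite lee_fin.
  by rewrite lerBrDr gerDl leNgt e0.
near=> N; rewrite ler_distl; apply/andP.
have fN : optimal_value setT (saa N) \is a fin_num by near: N.
have uN : optimal_value setT (saa N) <= (fine r + e)%:E by near: N; exact: upper.
have lN : (fine r - e)%:E <= optimal_value setT (saa N) by near: N.
move: uN lN; rewrite -{1 2}(fineK fN) !lee_fin /= => uN lN.
by split; rewrite ?lerBlDr ?lerBrDr//; lra.
Unshelve. all: by end_near. Qed.

End penalized_limit.

(** * Consistency of the regularized sample average approximation *)

Section almost_everywhere_law.
Context d d' (Omega : measurableType d) (S : measurableType d') (R : realType).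
Variable P : probability Omega R.

Lemma same_law_ae (xi X : {RV P >-> S}) (A : set S) : same_law X xi ->
  {ae distribution P xi, forall x, A x} -> {ae P, forall w, A (X w)}.
Proof.
move=> lX [N [mN N0 AN]]; exists (X @^-1` N); split.
- by rewrite -[_ @^-1` _]setTI; exact: measurable_funP.
- by have := lX N mN; rewrite N0.
- by move=> w /= nA; apply: AN.
Qed.

(** A nonnegative integrand with zero expectation vanishes almost surely; the
    exceptional set of values is measurable only for the completed law, so it is
    replaced by a measurable set of the same measure. *)
Lemma integral0_comp_completed (xi : {RV P >-> S}) (f : completed (distribution P xi) -> R) :
    measure_is_complete P -> measurable_fun setT f -> (forall x, 0 <= f x) ->
    (\int[P]_w (f (xi w))%:E = 0)%E ->
  {ae distribution P xi, forall x, f x = 0}.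
Proof.
move=> cP mf f0 If; set mu := distribution P xi.
have mfx : measurable_fun setT (fun w => (f (xi w))%:E).
  by apply/measurable_EFinP; apply: measurable_comp_completed.
have : (\int[P]_w `|(f (xi w))%:E| = 0)%E.
  by rewrite -[RHS]If; apply: eq_integral => w _; rewrite gee0_abs// lee_fin.
move=> /(ae_eq_integral_abs P measurableT mfx) [M [mM M0 fM]].
pose A : set (completed mu) := [set x | f x != 0].
have mA : measurable A.
  rewrite (_ : A = f @^-1` (~` [set 0])).
    by rewrite -[_ @^-1` _]setTI; apply: mf => //; exact: measurableC.
  by apply/seteqP; split => x /= /eqP.
have [A0 [N [mA0 mN N0 AA0]]] := completed_measurable_approx mA.
have lxi : same_law xi xi by [].
have [m1 m2 m3 PN] := completed_preimage cP lxi mA0 mN N0 AA0.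
exists (A0 `|` N); split; first exact: measurableU.
  apply/eqP; rewrite -measure_le0 (le_trans (measureU2 _ mA0 mN))//.
  rewrite [X in (_ + X)%E]N0 adde0 measure_le0; apply/eqP.
  change (P (xi @^-1` A0) = 0%E).
  rewrite -(measure_eq_off_null m1 m2 m3 PN) => [|w]; last exact: AA0.
  apply: (measure_negligible m1); exists M; split => // w /= fw.
  by apply: fM => /= /(_ I) []; move/eqP: fw.
move=> x /= fx; have [Nx|Nx] := pselect (N x); first by right.
by left; apply/AA0 => //; apply/eqP.
Qed.

End almost_everywhere_law.

Lemma sample_mean_liminf (R : realType) (V W : normedModType R) (S : Type)
    (B : dual V -> W) (g : W -> S -> R) (C : set W) (x : nat -> S) (l : W -> \bar R)
    (z_ : nat -> dual V) (phi : nat -> nat) z (c : R) :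
    (forall (u_ : nat -> dual V) v, weakstar_cvg u_ v -> (B \o u_) @ \oo --> B v) ->
    (forall w0 (c : R), C w0 -> (c%:E < l w0)%E ->
      exists2 O, nbhs w0 O & \forall N \near \oo, forall v', O v' -> C v' ->
      c * N%:R < \sum_(i < N) g v' (x i)) ->
    (forall k, (k < phi k)%N) -> (forall k, C (B (z_ k))) -> C (B z) ->
    weakstar_cvg z_ z -> (c%:E < l (B z))%E ->
  \forall k \near \oo, c < sample_mean (g (B (z_ k))) x (phi k).
Proof.
move=> Bcont Hg kphi Cz_ Cz zz cz; have [A nA [M _ HM]] := Hg _ _ Cz cz.
have [L _ HL] := Bcont _ _ zz _ nA.
exists (maxn M L) => // k /= kML.
have phi0 : 0 < (phi k)%:R :> R by rewrite ltr0n (leq_ltn_trans _ (kphi k)).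
rewrite /sample_mean ltr_pdivlMl// mulrC; apply: HM => //=.
  by rewrite (leq_trans (leq_trans (leq_maxl _ _) kML))// ltnW.
by apply: HL => /=; rewrite (leq_trans (leq_maxr _ _) kML).
Qed.


Theorem proposition3p4 (R : realType)
    (* probability space, random elements xi, xi^1, xi^2, ... (xis i = xi^{i+1}) *)
    (d : measure_display) (Omega : measurableType d) (P : probability Omega R)
    (Xi : completeMetricType R) (xi : {RV P >-> borel Xi})
    (xis : nat -> {RV P >-> borel Xi})
    (* U = dual V; Y and Y0 stand for the Banach spaces R and R_0, R being the reals;
       G is the R-valued version of G0 : W -> Xi -> R_0 *)
    (V W Y Y0 : completeNormedModType R)
    (iota : {linear Y -> Y0}) (B : {linear dual V -> W})
    (J : W -> Xi -> R) (G0 : W -> Xi -> Y0) (G : W -> Xi -> Y)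
    (K : set Y) (psi : dual V -> \bar R)
    (beta : Y -> R) (gamma : nat -> R) (u : nat -> Omega -> dual V) :
  let law := distribution P xi in
  let JB := fun (v : dual V) (x : Xi) => J (B v) x in
  let GB := fun (v : dual V) (x : Xi) => G (B v) x in
  let F := expected_cost P xi JB in
  let objective := fun v => (F v + psi v)%E in
  let feas := feasible law K GB in
  let saa := fun (N : nat) (w : Omega) =>
    saa_objective JB GB psi beta (gamma N) (fun i => xis i w) N in
  (* probabilistic setting *)
  measure_is_complete P ->
  separable Xi ->
  (forall i, same_law (xis i) xi) ->
  mutually_independent xis ->
  (* (G1) *)
  separable V -> separable W -> separable Y -> separable Y0 ->
  injective iota ->
  (* (G2) *)
  (forall (u_ : nat -> dual V) v,
     weakstar_cvg u_ v -> (B \o u_) @ \oo --> B v) ->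
  (* (G3) *)
  (forall w x, 0 <= J w x) ->
  random_lsc (completed law) J ->
  (* (G4) *)
  caratheodory_on (completed law) [set: W] G0 ->
  (forall v x, iota (G (B v) x) = G0 (B v) x) ->
  caratheodory_on (completed law) (B @` effective_domain psi) G ->
  K !=set0 -> closed K -> convex_set K -> cone K ->
  (* (G5) *)
  (forall v, (0 <= psi v)%E) ->
  proper_fun psi -> econvex psi -> seq_weakstar_lsc psi ->
  dual_bounded (effective_domain psi) ->
  seq_weakstar_closed (effective_domain psi) ->
  (* F is finite-valued *)
  (forall v, (F v < +oo)%E) ->
  (* (G6) *)
  (exists2 v, feas v & (objective v < +oo)%E) ->
  (* penalty function and penalty parameters *)
  continuous beta ->
  (forall y, 0 <= beta y) ->
  (forall y, beta y = 0 <-> K y) ->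
  (forall N, (0 < N)%N -> 0 < gamma N) ->
  gamma @ \oo --> +oo ->
  (* u N w solves the regularized SAA problem with sample size N *)
  (forall N w, (0 < N)%N -> is_solution [set: dual V] (saa N w) (u N w)) ->
  {ae P, forall w,
     (fun N => optimal_value [set: dual V] (saa N w)) @ \oo -->
       optimal_value feas objective /\
     forall ubar, weakstar_limit_point (fun N => u N w) ubar ->
       is_solution feas objective ubar}.
Proof.
move=> law JB GB F objective feas saa cP sXi lxis ixis sV sW sY sY0 iota_inj.
move=> Bcont J0 Jlsc cG0 iotaG cG K0 clK cvxK coneK psi0 psiP psiC psi_lsc.
move=> Dbnd Dcl Foo feas_ex betac beta0 betaK gamma0 gammaoo u_sol.
pose D := effective_domain psi.
pose f := fun v x => beta (G v x).
have Jmeas := random_lsc_open_infima Jlsc.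
have Jl := random_lsc_lsc Jlsc.
have fmeas := caratheodory_open_infima sW betac cG.
have fl := caratheodory_lsc betac cG.
have f0 v x : 0 <= f v x by exact: beta0.
have mJ v : measurable_fun setT (J v : completed law -> R).
  exact: (measurable_section Jmeas Jl).
have mf v : (B @` D) v -> measurable_fun setT (f v : completed law -> R).
  by move=> Dv; exact: (measurable_section fmeas fl).
have aeJ := epi_lln_lower cP lxis ixis sW J0 Jmeas Jl.
have aef := epi_lln_lower cP lxis ixis sW f0 fmeas fl.
have FE v : F v = (\int[P]_w (J (B v) (xi w))%:E)%E by rewrite /F /expected_cost unlock.
have F0 v : (0 <= F v)%E by rewrite FE; apply: integral_ge0 => w _; rewrite lee_fin.
pose H v := (\int[P]_w (f (B v) (xi w))%:E)%E.
have H0 v : (0 <= H v)%E by apply: integral_ge0 => w _; rewrite lee_fin.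
set r := optimal_value feas objective.
have r0 : (0 <= r)%E by apply: le_ereal_inf_tmp => _ [v _ <-]; exact: adde_ge0.
have rfin : r \is a fin_num.
  rewrite ge0_fin_numE//; have [v fv vo] := feas_ex; apply: le_lt_trans vo.
  by apply: ereal_inf_lbound; exists v.
(* A countable minimizing sequence of feasible points, so that the strong law and
   the constraint can be imposed on all of them almost surely. *)
have minseq k : exists v, [/\ feas v, D v & (objective v < (fine r + k.+1%:R^-1)%:E)%E].
  have k0 : 0 < k.+1%:R^-1 :> R by rewrite invr_gt0.
  have [_ [v fv <-] vr] := lb_ereal_inf_adherent k0 rfin.
  move: vr; rewrite -/(optimal_value _ _) -/r -{1}(fineK rfin) -EFinD => vr.
  exists v; split => //; apply: (le_lt_trans _ (lt_trans vr (ltry _))).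
  by rewrite leeDr.
pose v_ k := sval (cid (minseq k)).
have fv k : feas (v_ k) by case: (svalP (cid (minseq k))).
have Dv k : D (v_ k) by case: (svalP (cid (minseq k))).
have ov k : (objective (v_ k) < (fine r + k.+1%:R^-1)%:E)%E.
  by case: (svalP (cid (minseq k))).
have Ffin v : F v \is a fin_num by rewrite ge0_fin_numE.
have aeS : {ae P, forall w, forall k, \forall N \near \oo,
    \sum_(i < N) JB (v_ k) (xis i w) < (fine (F (v_ k)) + k.+1%:R^-1) * N%:R}.
  apply: ae_foralln => k.
  have iidJ := pairwise_iid_completed cP lxis ixis (mJ (B (v_ k))).
  apply: (lln_upper iidJ) => [i w|]; first exact: J0.
  rewrite (integral_comp_completed cP lxis)//.
  by rewrite -FE -{1}(fineK (Ffin _)) lte_fin ltrDl invr_gt0.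
have aeK : {ae P, forall w, forall k i, K (GB (v_ k) (xis i w))}.
  by apply: ae_foralln => k; apply: ae_foralln => i; exact: (same_law_ae (lxis i) (fv k)).
have aeF := ae_filter_ringOfSetsType P.
apply: (@filterS _ _ aeF _ _ _ (@filterI _ _ aeF _ _
  (@filterI _ _ aeF _ _ aeJ aef) (@filterI _ _ aeF _ _ aeS aeK))) => w [[HJ Hf] [HS HK]].
have BD z : D z -> (B @` D) (B z) by exists z.
have mean0 (g : Xi -> R) N : (forall x, 0 <= g x) -> 0 <= sample_mean g (fun i => xis i w) N.
  by move=> g0; rewrite mulr_ge0 ?invr_ge0// sumr_ge0.
apply: (@penalized_limit R V psi F H
  (fun N v => sample_mean (JB v) (fun i => xis i w) N)
  (fun N v => sample_mean (fun x => beta (GB v x)) (fun i => xis i w) N)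
  gamma feas (fun N => u N w)) => //.
- by move=> N v; apply: mean0 => x; exact: J0.
- by move=> N v; apply: mean0.
- move=> z_ phi z c kphi Dz_ Dz zz; rewrite FE => cz.
  exact: (@sample_mean_liminf R V W Xi B J setT (fun i => xis i w)
    (fun v => \int[P]_w (J v (xi w))%:E)%E z_ phi z c Bcont HJ kphi (fun=> I) I zz cz).
- move=> z_ phi z c kphi Dz_ Dz zz cz.
  exact: (@sample_mean_liminf R V W Xi B f (B @` D) (fun i => xis i w)
    (fun v => \int[P]_w (f v (xi w))%:E)%E z_ phi z c Bcont Hf kphi
    (fun k => BD _ (Dz_ k)) (BD _ Dz) zz cz).
- move=> z Dz Hz.
  have := integral0_comp_completed cP (mf _ (BD _ Dz)) (f0 _) Hz.
  by move=> [N [mN N0 HN]]; exists N; split => // x /= nK; apply: HN => /= /betaK.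
- move=> c rc.
  (* One half of the gap for the suboptimality of [v_ k], the other half for the
     deviation of its sample mean. *)
  have cr : 0 < (c - fine r) / 2.
    by rewrite divr_gt0// subr_gt0 -lte_fin (fineK rfin).
  have [k _ /(_ k (leqnn k)) kc] := near_infty_natSinv_lt (PosNum cr).
  have [M _ HM] := HS k; exists M.+1 => // N /= MN.
  have N0 : 0 < N%:R :> R by rewrite ltr0n (leq_ltn_trans _ MN).
  apply: (@le_trans _ _ (saa N w (v_ k))).
    by apply: ereal_inf_lbound; exists (v_ k).
  rewrite /saa /saa_objective.
  have -> : sample_mean (fun x => beta (GB (v_ k) x)) (fun i => xis i w) N = 0.
    rewrite /sample_mean big1 ?mulr0// => i _; exact/betaK.
  rewrite mulr0 adde0.
  have meanlt : sample_mean (JB (v_ k)) (fun i => xis i w) N <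
      fine (F (v_ k)) + k.+1%:R^-1.
    by rewrite /sample_mean ltr_pdivrMl// mulrC; apply: HM; exact: ltnW.
  have kc' : k.+1%:R^-1 < (c - fine r) / 2 := kc.
  have Pfin : psi (v_ k) \is a fin_num by rewrite ge0_fin_numE//; exact: Dv.
  move: (ov k); rewrite /objective -(fineK Pfin) -(fineK (Ffin (v_ k))).
  rewrite -!EFinD lte_fin lee_fin => ok.
  move: meanlt ok kc'; set m := sample_mean _ _ _; set y := _^-1.
  set p := fine (psi _); set q := fine (F _); lra.
- by move=> N N0; exact: u_sol.
Qed.
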